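(* Let $[M;\mathcal{L}]$ with $M=[A;P;B]$ be a countable formal mathematical system and let $\mathcal{D}$ be a model for $[M;\mathcal{L}]$, with universe $\mathcal{D}_*$, set of names $\mathcal{N}=\{\alpha_d : d\in\mathcal{D}_*\}$, predicates $p_n$ ($p\in P$, $n\ge 0$), and extended list sets $\hat{\mathcal{L}},\hat{\mathcal{L}}_*$. Let $[M'';\mathcal{L}'']$, the function $\psi$, the sets $A',\mathcal{N}',B',\mathcal{L}'$ and the system $[M';\mathcal{L}']$ with $M'=[A';P;B']$ be obtained from $[M;\mathcal{L}]$ and $\mathcal{D}$ by the construction described in the context, and let $\mathcal{L}'_*$, $\mathcal{L}''_*$ be the sets of variable-free lists in $\mathcal{L}'$, $\mathcal{L}''$. Then: (a) $[M';\mathcal{L}']$ is a complete countable Henkin system, and it extends the original countable system $[M;\mathcal{L}]$. (b) The complete Henkin system $[M'';\mathcal{L}'']$ is a conservative extension of $[M';\mathcal{L}']$. (c) Form the countable subset $\mathcal{D}_{0,*}=\{d\in\mathcal{D}_* : \alpha_d\in\mathcal{N}'\}\subseteq\mathcal{D}_*$, and note that $\mathcal{L}'_*\subseteq\mathcal{L}''_*=\hat{\mathcal{L}}_*$. Define the restriction $\mathcal{D}_0:\mathcal{L}'_*\to\mathcal{D}_{0,*}$ of $\mathcal{D}$ by $\mathcal{D}_0(\lambda)=\mathcal{D}(\lambda)$ for all $\lambda\in\mathcal{L}'_*$. For every $p\in P$ put $p'_0=p_0$ and $p'_n=p_n\cap\mathcal{D}_{0,*}^n$ for all $n\ge1$,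 and use the predicates $p'_n$, $n\geq 0$, to extend $\mathcal{D}_0$ to all closed formulas $F$ of $[M';\mathcal{L}']$ by $\mathcal{D}_0(F)=\mathcal{D}(F)$. Then $\mathcal{D}_0$ is a well-defined countable model of $[M;\mathcal{L}]$, and the models $\mathcal{D}$ and $\mathcal{D}_0$ are elementarily equivalent for $[M;\mathcal{L}]$. Here the names of $\mathcal{D}_0$ are the members of the countable set $\mathcal{N}'$, where $\alpha_d\in\mathcal{N}'$ denotes the same individual $d\in\mathcal{D}_{0,*}$ in both models.
   Context: ''Countable'' means finite or countably infinite. **Syntax.** $X=\{\mathbf{x}_1,\mathbf{x}_2,\ldots\}$ is the countably infinite alphabet of variables. Let $A$ be a set of constant/operation symbols and $P$ a set of predicate symbols. $A$-lists are the strings generated by: every $x\in X$ and every $a\in A$ is an $A$-list; if $\lambda$ is an $A$-list and $f\in A$ then $f(\lambda)$ is an $A$-list; if $\lambda,\mu$ are $A$-lists then the concatenation $\lambda\mu$ is an $A$-list. $\mathrm{var}(\lambda)$ is the set of variables occurring in $\lambda$; $\lambda\frac{\mu}{x}$ is the list obtained by replacing $x$ everywhere in $\lambda$ by $\mu$. Formulas are written in prefix notation. Prime formulas are $\sim\lambda,\mu$ (equality), $p$, and $p\,\lambda_1,\ldots,\lambda_n$ for $p\in P$, $n\ge1$ and argument lists $\lambda,\mu,\lambda_i$ (a predicate symbol may be used with any number of arguments). If $F,G$ are formulas and $x\in X$, then $\neg F$, $\to FG$, $\leftrightarrow FG$, $\&FG$, $\vee FG$, $\forall xF$, $\exists xF$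 are formulas. $\mathrm{var}(F)$ is the set of all variables of $F$, $\mathrm{free}(F)$ the set of variables occurring free in $F$; $F$ is closed if $\mathrm{free}(F)=\emptyset$. $F\frac{\lambda}{x}=\mathrm{SbF}(F;\lambda;x)$ is the result of replacing every free occurrence of $x$ in $F$ by $\lambda$. The condition $\mathrm{CF}(F;\lambda;x)$ says that this substitution is collision-free: no free occurrence of $x$ in $F$ lies in the scope of a quantifier $\forall y$ or $\exists y$ with $y\in\mathrm{var}(\lambda)$. **Formal mathematical systems.** $[M;\mathcal{L}]$ with $M=[A;P;B]$ consists of $A$, $P$, a set $\mathcal{L}$ of $A$-lists with $X\subseteq\mathcal{L}$ and $\lambda\frac{\mu}{x}\in\mathcal{L}$ for all $\lambda,\mu\in\mathcal{L}$, $x\in X$, and a set $B$ of formulas (basis axioms) with all argument lists in $\mathcal{L}$. Formulas of $[M;\mathcal{L}]$ are the formulas over $A,P$ all of whose argument lists are in $\mathcal{L}$. It is countable if $A$ and $P$ are countable. $\Pi(M;\mathcal{L})$ is the set of formulas of $[M;\mathcal{L}]$ provable by the following Hilbert-style calculus, in which all formulas have argument lists in $\mathcal{L}$. Axioms: the formulas in $B$; all $\alpha(F_1,\ldots,F_j)$ for propositional tautologies $\alpha$; equality axioms $\sim x,x$; $\to\mathrm{SbF}(\sim\lambda,\mu;x;y)\to\sim x,y\,\sim\lambda,\mu$ ($x,y\in X$, $\lambda,\mu\in\mathcal{L}$); $\to\sim x_1,y_1\ldots\to\sim x_n,y_n\to p\,x_1,\ldots,x_n\;p\,y_1,\ldots,y_n$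 ($p\in P$, $n\ge1$, $x_i,y_i\in X$); quantifier axioms $\to\forall xF\,F$; $\to\forall x\to FG\;\to F\,\forall xG$ if $x\notin\mathrm{free}(F)$; $\leftrightarrow\neg\forall x\neg F\;\exists xF$. Rules: (a) axioms may be written down; (b) from $F$ and $\to FG$ infer $G$; (c) from $F$ infer $F\frac{\lambda}{x}$ if $x\in X$, $\lambda\in\mathcal{L}$ and $\mathrm{CF}(F;\lambda;x)$; (d) from $F$ infer $\forall xF$. $[M;\mathcal{L}]$ is contradictory if every formula of $[M;\mathcal{L}]$ is in $\Pi(M;\mathcal{L})$, otherwise consistent. It is a Henkin system if for every $x\in X$ and every formula $F$ of $[M;\mathcal{L}]$ with $\mathrm{free}(F)\subseteq\{x\}$ there is a constant $c\in\mathcal{L}$ (a single symbol of $A$) with $\to\exists xF\,F\frac{c}{x}\in\Pi(M;\mathcal{L})$ (equivalently, with $\leftrightarrow$ instead of $\to$). It is complete if for every closed formula $F$ of $[M;\mathcal{L}]$: $F\notin\Pi(M;\mathcal{L})\Leftrightarrow\neg F\in\Pi(M;\mathcal{L})$. A system $[M_2;\mathcal{L}_2]$, $M_2=[A_2;P_2;B_2]$, is an extension of $[M_1;\mathcal{L}_1]$, $M_1=[A_1;P_1;B_1]$, if $A_1\subseteq A_2$, $P_1\subseteq P_2$, $\mathcal{L}_1\subseteq\mathcal{L}_2$ and $\Pi(M_1;\mathcal{L}_1)\subseteq\Pi(M_2;\mathcal{L}_2)$; it is a conservative extension if in addition every formula of $[M_1;\mathcal{L}_1]$ lying in $\Pi(M_2;\mathcal{L}_2)$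 lies in $\Pi(M_1;\mathcal{L}_1)$. **Models.** A model $\mathcal{D}$ of $[M;\mathcal{L}]$ consists of: (1) a nonempty set $\mathcal{D}_*$ (universe; its members are individuals); (2) for each $d\in\mathcal{D}_*$ exactly one name $\alpha_d$, with different individuals having different names; $\mathcal{N}=\{\alpha_d:d\in\mathcal{D}_*\}$ consists of symbols different from those of $[M;\mathcal{L}]$; (3) the extended system $[\hat M;\hat{\mathcal{L}}]$ with $\hat A=A\cup\mathcal{N}$, $\hat M=[\hat A;P;B]$, $\hat{\mathcal{L}}=\{\lambda\frac{\kappa_1}{x_1}\ldots\frac{\kappa_m}{x_m}:\lambda\in\mathcal{L},x_i\in X,\kappa_i\in\mathcal{N},m\ge0\}$; $\hat{\mathcal{L}}_*$ is the set of $\lambda\in\hat{\mathcal{L}}$ with $\mathrm{var}(\lambda)=\emptyset$; (4) a surjective function $\mathcal{D}:\hat{\mathcal{L}}_*\to\mathcal{D}_*$ with $\mathcal{D}(\lambda\frac{\mu}{x})=\mathcal{D}(\lambda\frac{\alpha_{\mathcal{D}(\mu)}}{x})$ for all $\mu\in\hat{\mathcal{L}}_*$, $x\in X$, $\lambda\in\hat{\mathcal{L}}$ with $\mathrm{var}(\lambda)\subseteq\{x\}$; (5) for each $p\in P$ and $n\in\mathbb{N}_0$ an $n$-ary predicate $p_n\subseteq\mathcal{D}_*^n$, where for $n=0$, $p_0\in\{\top,\bot\}$ is a truth value; (6) an extension of $\mathcal{D}$ assigning a truth value to each closed formula of $[\hat M;\hat{\mathcal{L}}]$: $\mathcal{D}(\sim\lambda,\mu)=\top$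 iff $\mathcal{D}(\lambda)=\mathcal{D}(\mu)$; $\mathcal{D}(p)=p_0$; $\mathcal{D}(p\,\lambda_1,\ldots,\lambda_n)=\top$ iff $(\mathcal{D}(\lambda_1),\ldots,\mathcal{D}(\lambda_n))\in p_n$; the connectives $\neg,\to,\leftrightarrow,\&,\vee$ are interpreted classically; for $\mathrm{free}(F)\subseteq\{x\}$, $\mathcal{D}(\forall xF)=\top$ iff $\mathcal{D}(F\frac{\lambda}{x})=\top$ for all $\lambda\in\hat{\mathcal{L}}_*$, and $\mathcal{D}(\exists xF)=\top$ iff $\mathcal{D}(F\frac{\lambda}{x})=\top$ for some $\lambda\in\hat{\mathcal{L}}_*$; (7) a formula $F$ of $[\hat M;\hat{\mathcal{L}}]$ with $\mathrm{free}(F)=\{x_1,\ldots,x_m\}$ is called valid in $\mathcal{D}$ iff $\mathcal{D}(F\frac{\lambda_1}{x_1}\ldots\frac{\lambda_m}{x_m})=\top$ for all $\lambda_1,\ldots,\lambda_m\in\hat{\mathcal{L}}_*$; (8) every $F\in B$ is valid in $\mathcal{D}$. A model is countable if its universe is countable. Two models of $[M;\mathcal{L}]$ are elementarily equivalent for $[M;\mathcal{L}]$ if they assign the same truth value to every closed formula of $[M;\mathcal{L}]$. **Construction.** Fix the countable $[M;\mathcal{L}]$ and its model $\mathcal{D}$. *The system $[M'';\mathcal{L}'']$:* $A''=\hat A$, $B''=\{G: G\text{ a formula of }[\hat M;\hat{\mathcal{L}}]\text{ valid in }\mathcal{D}\}$, $M''=[A'';P;B'']$, $\mathcal{L}''=\hat{\mathcal{L}}$.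 (It is a complete Henkin system.) *Henkin constants:* Put $A^{(0)}=A$, $\mathcal{L}^{(0)}=\mathcal{L}$, $M^{(0)}=M$. For each pair $(x;F)$ with $x\in X$ and $F$ a formula of $[M^{(0)};\mathcal{L}^{(0)}]$ with $\mathrm{free}(F)\subseteq\{x\}$ choose exactly one new constant $\omega_{\exists xF}$, a Henkin constant of rank 1; $\mathcal{H}^{(1)}$ is the set of these. For $n\ge2$, for each closed formula $\exists xF$ of $[M^{(n-1)};\mathcal{L}^{(n-1)}]$ such that at least one Henkin constant of rank $n-1$ occurs in $F$, form a new Henkin constant $\omega_{\exists xF}$ of rank $n$; $\mathcal{H}^{(n)}$ is the set of these. For $n\ge1$ put $A^{(n)}=A^{(n-1)}\cup\mathcal{H}^{(n)}$ (with $A^{(n-1)}\cap\mathcal{H}^{(n)}=\emptyset$), $M^{(n)}=[A^{(n)};P;B]$, $\mathcal{L}^{(n)}=\{\lambda\frac{c_1}{x_1}\ldots\frac{c_m}{x_m}:\lambda\in\mathcal{L}^{(n-1)},x_i\in X,c_i\in\mathcal{H}^{(n)},m\ge0\}$. Distinct pairs $(x;F)$ have distinct Henkin constants. Put $\mathcal{H}=\bigcup_{k\ge1}\mathcal{H}^{(k)}$, $A^{(\infty)}=\bigcup_n A^{(n)}$, $\mathcal{L}^{(\infty)}=\bigcup_n\mathcal{L}^{(n)}$, $M^{(\infty)}=[A^{(\infty)};P;B]$. *The function $\psi$ and the systems $[\tilde M^{(n)};\tilde{\mathcal{L}}^{(n)}]$, $\tilde M^{(n)}=[\tilde A^{(n)};P;\tilde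 B^{(n)}]$:* For $n=0$: $\tilde A^{(0)}=A$, $\tilde{\mathcal{L}}^{(0)}=\mathcal{L}$, $\tilde B^{(0)}=\{G:G\text{ a formula of }[M;\mathcal{L}]\text{ valid in }\mathcal{D}\}$, and $\psi(F)=F$ for every formula $F$ of $[M;\mathcal{L}]$. For $n\ge1$, suppose $\psi(F)$ is defined for all formulas $F$ of $[M^{(n-1)};\mathcal{L}^{(n-1)}]$ and $\psi(c)$ for all Henkin constants of rank $<n$. For each Henkin constant $\omega_{\exists xF}$ of rank $n$ choose exactly one $d\in\mathcal{D}_*$ with $\leftrightarrow\exists x\psi(F)\;\psi(F)\frac{\alpha_d}{x}\in\Pi(M'';\mathcal{L}'')$ (such $d$ exists) and put $\psi(\omega_{\exists xF})=\alpha_d$. If $F$ is a formula of $[M^{(n)};\mathcal{L}^{(n)}]$ in which exactly the distinct rank-$n$ Henkin constants $c_1,\ldots,c_j$ ($j\ge1$) occur, ordered by first occurrence, let $x_1,\ldots,x_j$ be distinct variables not in $\mathrm{var}(F)$, let $G$ (a formula of $[M^{(n-1)};\mathcal{L}^{(n-1)}]$) be $F$ with each $c_i$ replaced everywhere by $x_i$, and put $\psi(F)=\psi(G)\frac{\psi(c_1)}{x_1}\ldots\frac{\psi(c_j)}{x_j}$. Put $\tilde A^{(n)}=\tilde A^{(n-1)}\cup\{\psi(c):c\in\mathcal{H}^{(n)}\}$, $\tilde B^{(n)}=\{\psi(G):G\text{ a formula of }[M^{(n)};\mathcal{L}^{(n)}],\ \psi(G)\text{ valid in }\mathcal{D}\}$,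 $\tilde{\mathcal{L}}^{(n)}=\{\lambda\frac{\kappa_1}{x_1}\ldots\frac{\kappa_m}{x_m}:\lambda\in\tilde{\mathcal{L}}^{(n-1)},x_i\in X,\kappa_i\in\tilde A^{(n)}\setminus A,m\ge0\}$. *The system $[M';\mathcal{L}']$:* $A'=\bigcup_{n\ge0}\tilde A^{(n)}$, $\mathcal{N}'=A'\setminus A\subseteq\mathcal{N}$, $B'=\bigcup_{n\ge0}\tilde B^{(n)}$, $\mathcal{L}'=\bigcup_{n\ge0}\tilde{\mathcal{L}}^{(n)}$, $M'=[A';P;B']$. *)

(* Defs.v *)
From HB Require Import structures.
From mathcomp Require Import all_boot.
From mathcomp Require Import all_classical.

Set Implicit Arguments.
Unset Strict Implicit.
Unset Printing Implicit Defensive.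

Local Open Scope classical_set_scope.

(* All symbols other than variables and predicate symbols (the constants and
   operation symbols of every system, the names, the Henkin constants) are
   drawn from one ambient type Sy, and all predicate symbols from one type Pr,
   so that inclusions such as A `<=` A' are literal.  A list is a string, i.e.
   a sequence of tokens; the variable x_(i+1) is TVar i. *)

Inductive tok (Sy : Type) : Type :=
  | TVar of nat
  | TSym of Sy
  | TLpar
  | TRpar.
Arguments TVar {Sy} _.
Arguments TSym {Sy} _.
Arguments TLpar {Sy}.
Arguments TRpar {Sy}.

Section Syntax.
Variables (Sy : choiceType) (Pr : Type).
Local Notation str := (seq (tok Sy)).

Definition vlist (x : nat) : str := [:: TVar x].
Definition clist (c : Sy) : str := [:: TSym c].

Inductive alist (A : set Sy) : set str :=
  | alist_var x : alist A (vlist x)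
  | alist_sym a : A a -> alist A (clist a)
  | alist_app f l : A f -> alist A l ->
      alist A ([:: TSym f; TLpar] ++ l ++ [:: TRpar])
  | alist_cat l m : alist A l -> alist A m -> alist A (l ++ m).

Definition lvar (l : str) : seq nat :=
  pmap (fun t => if t is TVar x then Some x else None) l.

Definition lsyms (l : str) : seq Sy :=
  pmap (fun t => if t is TSym c then Some c else None) l.

Definition lsub (l m : str) (x : nat) : str :=
  flatten [seq if t is TVar y then if y == x then m else [:: t] else [:: t]
          | t <- l].

(* Replacement of the symbol c by the variable x. *)
Definition lrepl (l : str) (c : Sy) (x : nat) : str :=
  [seq if t is TSym a then if a == c then TVar x else t else t | t <- l].

Definition closed_lists (L : set str) : set str := [set l | L l /\ lvar l = [::]].

(* The lists l k_1/x_1 ... k_m/x_m with l in L, k_i in K and m >= 0. *)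
Inductive lext (L : set str) (K : set Sy) : set str :=
  | lext_base l : L l -> lext L K l
  | lext_sub l k x : lext L K l -> K k -> lext L K (lsub l (clist k) x).

(* A predicate symbol may take any number of arguments, including none. *)
Inductive fmla : Type :=
  | FEq of str & str
  | FPred of Pr & seq str
  | FNeg of fmla
  | FImp of fmla & fmla
  | FIff of fmla & fmla
  | FAnd of fmla & fmla
  | FOr of fmla & fmla
  | FAll of nat & fmla
  | FEx of nat & fmla.

Fixpoint fvar (F : fmla) : seq nat :=
  match F with
  | FEq l m => lvar l ++ lvar m
  | FPred _ ls => flatten (map lvar ls)
  | FNeg G => fvar G
  | FImp G H | FIff G H | FAnd G H | FOr G H => fvar G ++ fvar H
  | FAll x G | FEx x G => x :: fvar G
  end.

Fixpoint ffree (F : fmla) : seq nat :=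
  match F with
  | FEq l m => lvar l ++ lvar m
  | FPred _ ls => flatten (map lvar ls)
  | FNeg G => ffree G
  | FImp G H | FIff G H | FAnd G H | FOr G H => ffree G ++ ffree H
  | FAll x G | FEx x G => [seq y <- ffree G | y != x]
  end.

(* The symbols occurring in F, with repetitions, from left to right. *)
Fixpoint fsyms (F : fmla) : seq Sy :=
  match F with
  | FEq l m => lsyms l ++ lsyms m
  | FPred _ ls => flatten (map lsyms ls)
  | FNeg G => fsyms G
  | FImp G H | FIff G H | FAnd G H | FOr G H => fsyms G ++ fsyms H
  | FAll _ G | FEx _ G => fsyms G
  end.

Definition closed_fmla (F : fmla) : Prop := ffree F = [::].

(* SbF(F; l; x); bound variables are not renamed. *)
Fixpoint SbF (F : fmla) (l : str) (x : nat) : fmla :=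
  match F with
  | FEq m n => FEq (lsub m l x) (lsub n l x)
  | FPred p ms => FPred p [seq lsub m l x | m <- ms]
  | FNeg G => FNeg (SbF G l x)
  | FImp G H => FImp (SbF G l x) (SbF H l x)
  | FIff G H => FIff (SbF G l x) (SbF H l x)
  | FAnd G H => FAnd (SbF G l x) (SbF H l x)
  | FOr G H => FOr (SbF G l x) (SbF H l x)
  | FAll y G => if y == x then F else FAll y (SbF G l x)
  | FEx y G => if y == x then F else FEx y (SbF G l x)
  end.

Fixpoint CF (F : fmla) (l : str) (x : nat) : bool :=
  match F with
  | FEq _ _ | FPred _ _ => true
  | FNeg G => CF G l x
  | FImp G H | FIff G H | FAnd G H | FOr G H => CF G l x && CF H l x
  | FAll y G | FEx y G =>
      (y == x) || (CF G l x && ((x \in ffree G) ==> (y \notin lvar l)))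
  end.

Fixpoint frepl (F : fmla) (c : Sy) (x : nat) : fmla :=
  match F with
  | FEq l m => FEq (lrepl l c x) (lrepl m c x)
  | FPred p ls => FPred p [seq lrepl l c x | l <- ls]
  | FNeg G => FNeg (frepl G c x)
  | FImp G H => FImp (frepl G c x) (frepl H c x)
  | FIff G H => FIff (frepl G c x) (frepl H c x)
  | FAnd G H => FAnd (frepl G c x) (frepl H c x)
  | FOr G H => FOr (frepl G c x) (frepl H c x)
  | FAll y G => FAll y (frepl G c x)
  | FEx y G => FEx y (frepl G c x)
  end.

End Syntax.

Arguments vlist {Sy} x.
Arguments FEq {Sy Pr}.
Arguments FPred {Sy Pr}.

Inductive pform : Type :=
  | PVar of nat
  | PNeg of pform
  | PImp of pform & pform
  | PIff of pform & pform
  | PAnd of pform & pform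
  | POr of pform & pform.

Fixpoint peval (v : nat -> bool) (a : pform) : bool :=
  match a with
  | PVar i => v i
  | PNeg b => ~~ peval v b
  | PImp b c => peval v b ==> peval v c
  | PIff b c => peval v b == peval v c
  | PAnd b c => peval v b && peval v c
  | POr b c => peval v b || peval v c
  end.

Definition tautology (a : pform) : Prop := forall v, peval v a.

Section Systems.
Variables (Sy : choiceType) (Pr : Type).
Local Notation str := (seq (tok Sy)).
Local Notation fmla := (fmla Sy Pr).

Fixpoint pinst (s : nat -> fmla) (a : pform) : fmla :=
  match a with
  | PVar i => s i
  | PNeg b => FNeg (pinst s b)
  | PImp b c => FImp (pinst s b) (pinst s c)
  | PIff b c => FIff (pinst s b) (pinst s c)
  | PAnd b c => FAnd (pinst s b) (pinst s c)
  | POr b c => FOr (pinst s b) (pinst s c)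
  end.

Record system : Type := System {
  consts : set Sy;
  preds : set Pr;
  axioms : set fmla;
  lists : set str }.

Fixpoint is_fmla (S : system) (F : fmla) : Prop :=
  match F with
  | FEq l m => lists S l /\ lists S m
  | FPred p ls => preds S p /\ all [in lists S] ls
  | FNeg G => is_fmla S G
  | FImp G H | FIff G H | FAnd G H | FOr G H => is_fmla S G /\ is_fmla S H
  | FAll _ G | FEx _ G => is_fmla S G
  end.

Record is_system (S : system) : Prop := IsSystem {
  system_alist : lists S `<=` alist (consts S);
  system_var : forall x, lists S (vlist x);
  system_sub : forall l m x, lists S l -> lists S m -> lists S (lsub l m x);
  system_axioms : axioms S `<=` is_fmla S }.

Definition countable_system (S : system) : Prop :=
  countable (consts S) /\ countable (preds S).

(* ~x_1,y_1 -> (... -> (~x_n,y_n -> F)) for xys = [:: (x_1, y_1); ...]. *)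
Definition eq_prems (xys : seq (nat * nat)) (F : fmla) : fmla :=
  foldr (fun xy G => FImp (FEq (vlist xy.1) (vlist xy.2)) G) F xys.

Inductive provable (S : system) : set fmla :=
  | prov_basis F : axioms S F -> provable S F
  | prov_taut a s : tautology a -> is_fmla S (pinst s a) ->
      provable S (pinst s a)
  | prov_eq_refl x : provable S (FEq (vlist x) (vlist x))
  | prov_eq_subst x y l m : lists S l -> lists S m ->
      provable S (FImp (SbF (FEq l m) (vlist x) y)
                       (FImp (FEq (vlist x) (vlist y)) (FEq l m)))
  | prov_eq_pred p xys : preds S p -> (0 < size xys)%N ->
      provable S (eq_prems xys
        (FImp (FPred p [seq vlist xy.1 | xy <- xys])
              (FPred p [seq vlist xy.2 | xy <- xys])))
  | prov_all_elim x F : is_fmla S F -> provable S (FImp (FAll x F) F)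
  | prov_all_imp x F G : is_fmla S F -> is_fmla S G -> x \notin ffree F ->
      provable S (FImp (FAll x (FImp F G)) (FImp F (FAll x G)))
  | prov_ex x F : is_fmla S F ->
      provable S (FIff (FNeg (FAll x (FNeg F))) (FEx x F))
  | prov_mp F G : provable S F -> provable S (FImp F G) -> provable S G
  | prov_sub F l x : provable S F -> lists S l -> CF F l x ->
      provable S (SbF F l x)
  | prov_gen F x : provable S F -> provable S (FAll x F).

Definition henkin (S : system) : Prop :=
  forall x F, is_fmla S F -> {subset ffree F <= [:: x]} ->
  exists c, [/\ consts S c, lists S (clist c) &
    provable S (FImp (FEx x F) (SbF F (clist c) x))].

Definition complete (S : system) : Prop :=
  forall F, is_fmla S F -> closed_fmla F ->
  (~ provable S F <-> provable S (FNeg F)).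

Definition extension (S2 S1 : system) : Prop :=
  [/\ consts S1 `<=` consts S2, preds S1 `<=` preds S2,
      lists S1 `<=` lists S2 & provable S1 `<=` provable S2].

Definition conservative_extension (S2 S1 : system) : Prop :=
  extension S2 S1 /\
  forall F, is_fmla S1 F -> provable S2 F -> provable S1 F.

End Systems.

Section Models.
Variables (Sy : choiceType) (Pr U : Type).
Local Notation str := (seq (tok Sy)).
Local Notation fmla := (fmla Sy Pr).
Local Notation system := (system Sy Pr).

(* The individuals form a subset of the ambient type U.  The predicate p_n is
   the part of [interp p] consisting of the sequences of length n; for n = 0
   this is the truth value of [interp p [::]].  The functions [name], [dval] and
   [truth] only matter on the universe, on the variable-free lists and on the
   closed formulas of the extended system, respectively. *)
Record model : Type := Model {
  universe : set U;
  name : U -> Sy;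
  dval : str -> U;
  interp : Pr -> set (seq U);
  truth : fmla -> Prop }.

Definition names (D : model) : set Sy := name D @` universe D.

Definition hat (S : system) (D : model) : system :=
  System (consts S `|` names D) (preds S) (axioms S) (lext (lists S) (names D)).

Definition hat_closed (S : system) (D : model) : set str :=
  closed_lists (lists (hat S D)).

Definition valid (S : system) (D : model) (F : fmla) : Prop :=
  forall xs : seq nat, uniq xs -> xs =i ffree F ->
  forall lam : nat -> str, (forall x, x \in xs -> hat_closed S D (lam x)) ->
  truth D (foldl (fun G x => SbF G (lam x) x) F xs).

Definition is_closed_fmla (S : system) (F : fmla) : Prop :=
  is_fmla S F /\ closed_fmla F.

Record is_model (S : system) (D : model) : Prop := IsModel {
  model_nonempty : universe D !=set0;
  model_name_inj : set_inj (universe D) (name D);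
  model_name_new : names D `&` consts S = set0;
  model_val_fun : set_fun (hat_closed S D) (universe D) (dval D);
  model_val_surj : set_surj (hat_closed S D) (universe D) (dval D);
  model_val_sub : forall l m x,
    lists (hat S D) l -> {subset lvar l <= [:: x]} -> hat_closed S D m ->
    dval D (lsub l m x) = dval D (lsub l (clist (name D (dval D m))) x);
  model_interp : forall p, preds S p ->
    interp D p `<=` [set ds | all [in universe D] ds];
  model_eq : forall l m, is_closed_fmla (hat S D) (FEq l m) ->
    (truth D (FEq l m) <-> dval D l = dval D m);
  model_pred : forall p ls, is_closed_fmla (hat S D) (FPred p ls) ->
    (truth D (FPred p ls) <-> interp D p (map (dval D) ls));
  model_neg : forall F, is_closed_fmla (hat S D) (FNeg F) ->
    (truth D (FNeg F) <-> ~ truth D F);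
  model_imp : forall F G, is_closed_fmla (hat S D) (FImp F G) ->
    (truth D (FImp F G) <-> (truth D F -> truth D G));
  model_iff : forall F G, is_closed_fmla (hat S D) (FIff F G) ->
    (truth D (FIff F G) <-> (truth D F <-> truth D G));
  model_and : forall F G, is_closed_fmla (hat S D) (FAnd F G) ->
    (truth D (FAnd F G) <-> truth D F /\ truth D G);
  model_or : forall F G, is_closed_fmla (hat S D) (FOr F G) ->
    (truth D (FOr F G) <-> truth D F \/ truth D G);
  model_all : forall x F, is_fmla (hat S D) F -> {subset ffree F <= [:: x]} ->
    (truth D (FAll x F) <->
     forall l, hat_closed S D l -> truth D (SbF F l x));
  model_ex : forall x F, is_fmla (hat S D) F -> {subset ffree F <= [:: x]} ->
    (truth D (FEx x F) <->
     exists2 l, hat_closed S D l & truth D (SbF F l x));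
  model_axioms : axioms S `<=` valid S D }.

Definition countable_model (D : model) : Prop := countable (universe D).

Definition elementarily_equivalent (S : system) (D1 D2 : model) : Prop :=
  forall F, is_closed_fmla S F -> (truth D1 F <-> truth D2 F).

End Models.

Section HenkinConstants.
Variables (Sy : choiceType) (Pr : Type).
Local Notation str := (seq (tok Sy)).
Local Notation fmla := (fmla Sy Pr).
Local Notation system := (system Sy Pr).
Variables (S : system) (omega : nat -> fmla -> Sy).

(* The pairs (x; F) giving rise to the Henkin constants of rank n + 1, where T
   is the n-th system and H the set of Henkin constants of rank n. *)
Definition new_pairs (n : nat) (T : system) (H : set Sy) : set (nat * fmla) :=
  [set xF | [/\ is_fmla T xF.2, {subset ffree xF.2 <= [:: xF.1]} &
    n = 0 \/ exists2 c, H c & c \in fsyms xF.2]].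

(* The pair consisting of the n-th system [M^(n); L^(n)] and of H^(n), with the
   convention that H^(0) is empty. *)
Fixpoint hstage (n : nat) : system * set Sy :=
  if n is m.+1 then
    let: (T, H) := hstage m in
    let H' := [set omega xF.1 xF.2 | xF in new_pairs m T H] in
    (System (consts T `|` H') (preds S) (axioms S) (lext (lists T) H'), H')
  else (S, set0).

Definition hsys (n : nat) : system := (hstage n).1.
Definition hconst (n : nat) : set Sy := (hstage n).2.
Definition hpairs (n : nat) : set (nat * fmla) :=
  new_pairs n (hsys n) (hconst n).

(* omega x F is the Henkin constant of the formula FEx x F; only its values on
   the pairs in some [hpairs n] are used. *)
Record henkin_constants : Prop := HenkinConstants {
  hconst_new : forall n, consts (hsys n) `&` hconst n.+1 = set0;
  hconst_inj : forall m n x y F G, hpairs m (x, F) -> hpairs n (y, G) ->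
    omega x F = omega y G -> x = y /\ F = G }.

(* The Henkin constants of rank n occurring in F, ordered by first occurrence;
   as undup keeps last occurrences, it is applied to the reversed sequence. *)
Definition hconsts_of (n : nat) (F : fmla) : seq Sy :=
  rev (undup (rev [seq c <- fsyms F | c \in hconst n])).

End HenkinConstants.

Section Construction.
Variables (Sy : choiceType) (Pr U : Type).
Local Notation str := (seq (tok Sy)).
Local Notation fmla := (fmla Sy Pr).
Local Notation system := (system Sy Pr).
Variables (S : system) (D : model Sy Pr U).

Definition Mpp : system :=
  System (consts S `|` names D) (preds S)
    [set G | is_fmla (hat S D) G /\ valid S D G]
    (lists (hat S D)).

Variable omega : nat -> fmla -> Sy.

(* The function psi of the construction, given by its values psic on Henkin
   constants and psi on formulas. *)
Variables (psic : Sy -> Sy) (psi : fmla -> fmla).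

Record psi_construction : Prop := PsiConstruction {
  psi_base : forall F, is_fmla S F -> psi F = F;
  psi_const : forall n x F, hpairs S omega n (x, F) ->
    exists d, [/\ universe D d, psic (omega x F) = name D d &
      provable Mpp
        (FIff (FEx x (psi F)) (SbF (psi F) (clist (name D d)) x))];
  psi_step : forall n F, is_fmla (hsys S omega n.+1) F ->
    let cs := hconsts_of S omega n.+1 F in
    cs != [::] ->
    exists xs : seq nat,
      [/\ size xs = size cs, uniq xs, (forall x, x \in xs -> x \notin fvar F) &
      let G := foldl (fun K cx => frepl K cx.1 cx.2) F (zip cs xs) in
      psi F =
        foldl (fun K cx => SbF K (clist (psic cx.1)) cx.2) (psi G) (zip cs xs)]
}.

Fixpoint tconsts (n : nat) : set Sy :=
  if n is m.+1 then tconsts m `|` psic @` hconst S omega m.+1 else consts S.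

Definition taxioms (n : nat) : set fmla :=
  if n is 0 then [set G | is_fmla S G /\ valid S D G]
  else [set psi G | G in
         [set G | is_fmla (hsys S omega n) G /\ valid S D (psi G)]].

Fixpoint tlists (n : nat) : set str :=
  if n is m.+1 then lext (tlists m) (tconsts m.+1 `\` consts S) else lists S.

Definition Mp : system :=
  System (\bigcup_n tconsts n) (preds S) (\bigcup_n taxioms n)
    (\bigcup_n tlists n).

Definition names' : set Sy := consts Mp `\` consts S.

Definition universe0 : set U := [set d | universe D d /\ names' (name D d)].

(* The restriction of D; the values of [dval] and [truth] are those of D. *)
Definition D0 : model Sy Pr U :=
  Model universe0 (name D) (dval D)
    (fun p => interp D p `&` [set ds | all [in universe0] ds])
    (truth D).

End Construction.

(* Main.v *)
Require Import Defs.
From mathcomp Require Import all_boot.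
From mathcomp Require Import all_classical.
From mathcomp Require Import zify.

(** A list of one of the extended systems is a list of the original one in which
    variables have been replaced by variables and new constants
    ([lext_decomp], [lext_compose]); hence adjoining constants preserves closure
    under substitution ([subst_closed_lext]).  The calculus is sound for the
    model; this is proved for the evaluation [ev] of formulas under
    assignments of individuals to variables.  It agrees with the truth values of
    the model on closed formulas ([truth_ev]), because every individual is the
    value of a variable-free list and a variable-free list may be exchanged for
    the name of its value.  So the theorems of [Mpp] are exactly the valid
    formulas ([provable_Mpp]), and [Mpp] is a complete Henkin system: the
    constant for [FEx x F] is the name of a witness.

    The function psi replaces every Henkin constant in a formula by the name
    chosen for it and changes nothing else ([psiE]).  Conversely every formula of
    [Mp] is a value of psi ([Mp_fmla_lift]): it contains finitely many names, each
    of them chosen for some Henkin constant.  The axioms of [Mp] are therefore all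
    its formulas valid in the model, so that its theorems are its valid formulas
    ([provable_Mp]).  This is conservativity, and completeness is inherited from
    [Mpp].  For the Henkin property, write F as psi G; the pair (x; G) has a
    Henkin constant, whose name is a witness for F ([Mp_witness]).

    The restricted model differs from the given one only in the range of its
    quantifiers, and by [Mp_witness] a formula of [Mp] that has a witness or a
    counterexample has one in the smaller universe (the Tarski-Vaught criterion).
    Applied to the formula x = l, the same lemma shows that the value of a
    variable-free list l of [Mp] lies in the smaller universe
    ([dval_universe0]).  Everything is countable since there are only countably
    many formulas over countably many symbols ([countable_fmlas]). *)

Set Implicit Arguments.
Unset Strict Implicit.
Unset Printing Implicit Defensive.

Local Open Scope classical_set_scope.

(** * Simultaneous substitution in lists *)

Section Lists.
Variable Sy : choiceType.
Local Notation str := (seq (tok Sy)).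
Implicit Types (l m : str) (x y : nat) (th et : nat -> str) (L : set str).

(** Simultaneous replacement of every variable [x] of a list by [th x]; the
    operation [lsub] replaces one variable at a time. *)
Definition lsubs th l : str :=
  flatten [seq if t is TVar y then th y else [:: t] | t <- l].

Lemma lsubE l m x :
  lsub l m x = lsubs (fun y => if y == x then m else vlist y) l.
Proof. by congr flatten; apply: eq_map => -[]. Qed.

Lemma lsubs_cat th l m : lsubs th (l ++ m) = lsubs th l ++ lsubs th m.
Proof. by rewrite /lsubs map_cat flatten_cat. Qed.

Lemma lsubs_cons th t l :
  lsubs th (t :: l) = (if t is TVar y then th y else [:: t]) ++ lsubs th l.
Proof. by []. Qed.

Lemma lvar_cat l m : lvar (l ++ m) = lvar l ++ lvar m.
Proof. exact: pmap_cat. Qed.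

Lemma lsyms_cat l m : lsyms (l ++ m) = lsyms l ++ lsyms m.
Proof. exact: pmap_cat. Qed.

Lemma lsubs_vlist th x : lsubs th (vlist x) = th x.
Proof. by rewrite /lsubs /= cats0. Qed.

Lemma eq_in_lsubs th et l :
  (forall x, x \in lvar l -> th x = et x) -> lsubs th l = lsubs et l.
Proof.
elim: l => // t l IH H; rewrite !lsubs_cons IH => [|x xl].
  by case: t H => // x /(_ x) /= -> //; rewrite inE eqxx.
by apply: H; case: t => //= y; rewrite inE xl orbT.
Qed.

Lemma lsubs_id th l : (forall x, x \in lvar l -> th x = vlist x) ->
  lsubs th l = l.
Proof.
move=> /eq_in_lsubs ->; elim: l => //= t l IH.
by rewrite lsubs_cons IH; case: t.
Qed.

Lemma lsubs_comp th et l :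
  lsubs th (lsubs et l) = lsubs (fun x => lsubs th (et x)) l.
Proof.
by elim: l => // t l IH; rewrite !lsubs_cons lsubs_cat IH; case: t.
Qed.

Lemma lvar_lsubs th l : lvar (lsubs th l) = flatten [seq lvar (th x) | x <- lvar l].
Proof.
by elim: l => // t l IH; rewrite lsubs_cons lvar_cat IH; case: t.
Qed.

Lemma mem_lvar_lsubs th l y : y \in lvar (lsubs th l) ->
  exists2 x, x \in lvar l & y \in lvar (th x).
Proof. by rewrite lvar_lsubs => /flatten_mapP[x xl yx]; exists x. Qed.

Lemma lvar_lsubs_closed th l : (forall x, x \in lvar l -> lvar (th x) = [::]) ->
  lvar (lsubs th l) = [::].
Proof.
rewrite lvar_lsubs; elim: (lvar l) => //= x s IH H.
by rewrite H ?mem_head// IH// => y ys; rewrite H// inE ys orbT.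
Qed.

(** The two closure properties that every system requires of its lists. *)
Definition subst_closed L : Prop :=
  (forall x, L (vlist x)) /\
  forall l m x, L l -> L m -> L (lsub l m x).

(** If the replaced variables do not occur in the lists put for them, then a
   simultaneous substitution can be made one variable at a time. *)
Lemma lsubs_sequential (Q : set str) th (xs : seq nat) l :
  (forall m x, x \in xs -> Q m -> Q (lsub m (th x) x)) ->
  (forall x y, x \in xs -> y \in lvar (th x) -> y \notin xs) ->
  Q l -> Q (lsubs (fun y => if y \in xs then th y else vlist y) l).
Proof.
elim: xs => [|x xs IH] Qs dis Ql; first by rewrite lsubs_id.
have {}IH : Q (lsubs (fun y => if y \in xs then th y else vlist y) l).
  apply: IH => // [m y yxs|y z yxs zy]; first by apply: Qs; rewrite inE yxs orbT.
  have := dis y z; rewrite !inE yxs orbT => /(_ isT zy).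
  by rewrite negb_or => /andP[].
have := Qs _ x (mem_head _ _) IH; rewrite lsubE lsubs_comp.
congr Q; apply: eq_in_lsubs => y _; rewrite inE.
case: (boolP (y \in xs)) => yxs; last by rewrite lsubs_vlist orbF; case: eqP => // ->.
rewrite orbT lsubs_id // => z zy; case: eqP => // zx.
have := dis y z; rewrite !inE yxs orbT => /(_ isT zy).
by rewrite zx eqxx.
Qed.

Lemma fresh_bound (s : seq nat) : exists N, forall x, x \in s -> (x < N)%N.
Proof.
exists (\max_(x <- s) x).+1 => x xs.
by rewrite ltnS; apply: leq_bigmax_seq.
Qed.

(** The variables are first renamed apart from all the lists to be inserted. *)
Lemma subst_closed_lsubs L th l : subst_closed L -> L l ->
  (forall x, L (th x)) -> L (lsubs th l).
Proof.
move=> [Lv Ls] Ll Lth.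
have [N HN] := fresh_bound (lvar l ++ flatten [seq lvar (th x) | x <- lvar l]).
have Nl x : x \in lvar l -> (x < N)%N by move=> xl; apply: HN; rewrite mem_cat xl.
have Nth x y : x \in lvar l -> y \in lvar (th x) -> (y < N)%N.
  move=> xl yx; apply: HN; rewrite mem_cat; apply/orP; right.
  by apply/flatten_mapP; exists x.
have L1 : L (lsubs (fun y => vlist (y + N)) l).
  have := @lsubs_sequential L (fun y => vlist (y + N)) (lvar l) l.
  rewrite (@eq_in_lsubs _ (fun y => vlist (y + N))); last by move=> y ->.
  apply=> //; first by move=> m x _ Lm; apply: Ls.
  move=> x y _; rewrite inE => /eqP ->; apply/negP => /Nl; lia.
pose xs := [seq y + N | y <- lvar l].
have := @lsubs_sequential L (fun y => th (y - N)) xs _ _ _ L1.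
rewrite lsubs_comp (@eq_in_lsubs _ th).
  apply; first by move=> m x _ Lm; apply: Ls.
  move=> _ y /mapP[x xl ->]; rewrite addnK => /(Nth _ _ xl) yN.
  by apply/negP => /mapP[z _]; lia.
by move=> x xl; rewrite lsubs_vlist ifT ?addnK//; apply: map_f.
Qed.

(** ** Adjoining constants to a set of lists *)

Variable (L : set str) (K : set Sy).
Hypothesis HL : subst_closed L.

(** The lists that are a variable or an adjoined constant. *)
Let atomic l := (exists y, l = vlist y) \/ exists2 k, K k & l = clist k.

Lemma lext_decomp l : lext L K l ->
  exists l0 s, [/\ L l0, forall x, atomic (s x) & l = lsubs s l0].
Proof.
elim=> [{}l Ll|{}l k x _ [l0 [s [Ll0 As ->]]] Kk].
  by exists l, vlist; split => // [x|]; [left; exists x|rewrite lsubs_id].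
exists l0, (fun y => lsub (s y) (clist k) x); split => // [y|].
  case: (As y) => [[z ->]|[k' Kk' ->]]; last by right; exists k'.
  by rewrite lsubE lsubs_vlist; case: ifP; [right; exists k|left; exists z].
by rewrite lsubE lsubs_comp; apply: eq_in_lsubs => y _; rewrite lsubE.
Qed.

(** Variables to be replaced by constants are first renamed above all variables
   that are the images of the others. *)
Lemma lext_compose l0 s : L l0 -> (forall x, atomic (s x)) ->
  lext L K (lsubs s l0).
Proof.
move=> Ll0 As.
have [N HN] := fresh_bound (lvar l0 ++ flatten [seq lvar (s x) | x <- lvar l0]).
pose e x := if lvar (s x) is [::] then vlist (x + N) else s x.
have Le : lext L K (lsubs e l0).
  apply: lext_base; apply: subst_closed_lsubs => // x; rewrite /e.
  by case: (As x) => [[y ->]|[k Kk ->]] /=; apply: HL.1.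
pose xs := [seq x + N | x <- lvar l0 & nilp (lvar (s x))].
have := @lsubs_sequential _ (fun y => s (y - N)) xs _ _ _ Le.
rewrite lsubs_comp (@eq_in_lsubs _ s); last first.
  move=> x xl; rewrite /e; case: (As x) => [[y E]|[k Kk E]]; rewrite E /=.
    rewrite lsubs_vlist ifF//; apply/negP => /mapP[z _ yz].
    have : (y < N)%N; last by lia.
    apply: HN; rewrite mem_cat; apply/orP; right.
    by apply/flatten_mapP; exists x => //; rewrite E mem_head.
  rewrite lsubs_vlist addnK E ifT//; apply/mapP; exists x => //.
  by rewrite mem_filter E.
apply.
  move=> m _ /mapP[x + ->]; rewrite mem_filter addnK => /andP[+ _] Lm.
  by case: (As x) => [[y ->]|[k Kk ->]] // _; apply: lext_sub.
by move=> _ y /mapP[x + ->]; rewrite mem_filter addnK => /andP[/nilP -> _].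
Qed.

Lemma subst_closed_lext : subst_closed (lext L K).
Proof.
split=> [x|_ _ x /lext_decomp[l0 [s [Ll0 As ->]]] /lext_decomp[m0 [t [Lm0 At ->]]]].
  exact: lext_base (HL.1 x).
(* Renaming the variables of l0 to odd and those of m0 to even numbers keeps
   their images under s and t apart. *)
pose u z := if lvar (s z) == [:: x] then lsubs (fun w => vlist w.*2) m0
            else vlist z.*2.+1.
pose v z := if odd z then s z./2 else t z./2.
have -> : lsub (lsubs s l0) (lsubs t m0) x = lsubs v (lsubs u l0).
  rewrite lsubE !lsubs_comp; apply: eq_in_lsubs => z _; rewrite /u.
  have Hv : lsubs v (vlist z.*2.+1) = s z.
    by rewrite lsubs_vlist /v /= odd_double /= uphalf_double.
  case: (As z) => [[y E]|[k Kk E]]; rewrite E; last by rewrite /= Hv E.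
  rewrite lsubs_vlist /= eqseq_cons andbT; case: ifP => _; last by rewrite Hv.
  rewrite lsubs_comp; apply: eq_in_lsubs => w _.
  by rewrite lsubs_vlist /v odd_double doubleK.
apply: lext_compose => [|z]; last by rewrite /v; case: ifP.
apply: subst_closed_lsubs => // z; rewrite /u; case: ifP => _; last exact: HL.1.
by apply: subst_closed_lsubs => // w; exact: HL.1.
Qed.

Lemma lext_clist k : K k -> lext L K (clist k).
Proof.
move=> Kk; have -> : clist k = lsub (vlist 0) (clist k) 0 by [].
by apply: lext_sub => //; apply/lext_base/HL.1.
Qed.

End Lists.

(** * Formulas *)

Section Formulas.
Variables (Sy : choiceType) (Pr : Type).
Local Notation str := (seq (tok Sy)).
Local Notation fmla := (fmla Sy Pr).
Local Notation system := (system Sy Pr).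
Implicit Types (F G : fmla) (l m : str) (T : system) (h : tok Sy -> tok Sy).

(** Application of a map of tokens to all lists of a formula; the quantified
    variables are left unchanged. *)
Fixpoint ftok h F : fmla :=
  match F with
  | FEq l m => FEq (map h l) (map h m)
  | FPred p ls => FPred p [seq map h l | l <- ls]
  | FNeg G => FNeg (ftok h G)
  | FImp G H => FImp (ftok h G) (ftok h H)
  | FIff G H => FIff (ftok h G) (ftok h H)
  | FAnd G H => FAnd (ftok h G) (ftok h H)
  | FOr G H => FOr (ftok h G) (ftok h H)
  | FAll x G => FAll x (ftok h G)
  | FEx x G => FEx x (ftok h G)
  end.

Fixpoint bound_vars F : seq nat :=
  match F with
  | FEq _ _ | FPred _ _ => [::]
  | FNeg G => bound_vars G
  | FImp G H | FIff G H | FAnd G H | FOr G H => bound_vars G ++ bound_vars H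
  | FAll x G | FEx x G => x :: bound_vars G
  end.

(** The tokens that may occur in the lists of [F]; parentheses always may. *)
Definition tok_in F (t : tok Sy) : bool :=
  match t with TVar x => x \in fvar F | TSym c => c \in fsyms F | _ => true end.

Lemma map_eq_tok h h' l :
  (forall t, match t with TVar x => x \in lvar l | TSym c => c \in lsyms l
             | _ => true end -> h t = h' t) ->
  map h l = map h' l.
Proof.
elim: l => //= t l IH H; rewrite IH => [|u ul].
  by rewrite H//; case: t H => //= ? _; rewrite mem_head.
by apply: H; case: u ul => //= z zl; case: t => //= w; rewrite inE zl orbT.
Qed.

Lemma eq_ftok h h' F : (forall t, tok_in F t -> h t = h' t) ->
  ftok h F = ftok h' F.
Proof.
elim: F => /=.
- move=> l m H; congr FEq; apply: map_eq_tok => t tl; apply: H;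
    by case: t tl => //= z zl; rewrite mem_cat zl ?orbT.
- move=> p ls H; congr FPred; elim: ls H => //= l ls IH H.
  congr (_ :: _); last first.
    by apply: IH => t tl; apply: H; case: t tl => //= z zl; rewrite mem_cat zl orbT.
  apply: map_eq_tok => t tl; apply: H.
  by case: t tl => //= z zl; rewrite mem_cat zl.
- by move=> G IH H; rewrite IH.
1-4: move=> G IG H IH E; rewrite IG ?IH// => t tG; apply: E;
  by case: t tG => //= z zl; rewrite mem_cat zl ?orbT.
1,2: move=> x G IH E; rewrite IH// => t tG; apply: E;
  by case: t tG => //= z zl; rewrite inE zl orbT.
Qed.

Lemma ftok_id F : ftok id F = F.
Proof.
elim: F => /= [l m|p ls|G ->|G -> H ->|G -> H ->|G -> H ->|G -> H ->|x G ->|x G ->] //.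
  by rewrite (map_id l) (map_id m).
by congr FPred; elim: ls => //= l ls ->; rewrite (map_id l).
Qed.

Lemma ftok_comp h h' F : ftok h (ftok h' F) = ftok (h \o h') F.
Proof.
elim: F => /= [l m|p ls|G ->|G -> H ->|G -> H ->|G -> H ->|G -> H ->|x G ->|x G ->] //.
  by rewrite -!map_comp.
by congr FPred; rewrite -map_comp; apply: eq_map => l /=; rewrite -map_comp.
Qed.

Lemma bound_vars_ftok h F : bound_vars (ftok h F) = bound_vars F.
Proof.
by elim: F => //= [G -> H ->|G -> H ->|G -> H ->|G -> H ->|x G ->|x G ->].
Qed.

Lemma bound_vars_fvar F : {subset bound_vars F <= fvar F}.
Proof.
elim: F => //=.
1-4: move=> G IG H IH x; rewrite !mem_cat => /orP[/IG|/IH] ->; by rewrite ?orbT.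
1,2: by move=> y G IG x; rewrite !inE => /orP[|/IG] ->; rewrite ?orbT.
Qed.

(** Replacement of a symbol by a variable, and of a variable by a symbol, in a
    single token. *)
Definition trepl (c : Sy) (x : nat) (t : tok Sy) : tok Sy :=
  if t is TSym a then if a == c then TVar x else t else t.

Definition tsub (c : Sy) (x : nat) (t : tok Sy) : tok Sy :=
  if t is TVar y then if y == x then TSym c else t else t.

Lemma frepl_ftok F c x : frepl F c x = ftok (trepl c x) F.
Proof.
by elim: F => //= [G ->|G -> H ->|G -> H ->|G -> H ->|G -> H ->|y G ->|y G ->].
Qed.

Lemma lsub_clist l c x : lsub l (clist c) x = map (tsub c x) l.
Proof.
by rewrite lsubE; elim: l => //= -[y|d||] l IH; rewrite lsubs_cons IH//=; case: eqP.
Qed.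

Lemma SbF_ftok F c x : x \notin bound_vars F ->
  SbF F (clist c) x = ftok (tsub c x) F.
Proof.
elim: F => //=.
- by move=> l m _; rewrite !lsub_clist.
- move=> p ls _; congr FPred; apply: eq_map => l; exact: lsub_clist.
- by move=> G IH /IH ->.
1-4: by move=> G IG H IH; rewrite mem_cat negb_or => /andP[/IG -> /IH ->].
1,2: move=> y G IG; rewrite inE negb_or eq_sym => /andP[/negbTE -> /IG ->] //.
Qed.

(** Renaming of the symbols other than variables and predicate symbols. *)
Definition tsym (g : Sy -> Sy) (t : tok Sy) : tok Sy :=
  if t is TSym c then TSym (g c) else t.

Lemma lvar_tsym g l : lvar (map (tsym g) l) = lvar l.
Proof. by elim: l => // -[x|c||] l IH //=; rewrite IH. Qed.

Lemma ffree_tsym g F : ffree (ftok (tsym g) F) = ffree F.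
Proof.
elim: F => //= [l m|p ls|G -> H ->|G -> H ->|G -> H ->|G -> H ->|x G ->|x G ->] //.
  by rewrite !lvar_tsym.
by congr flatten; rewrite -map_comp; apply: eq_map => l /=; rewrite lvar_tsym.
Qed.

Lemma lsub_tsym g l m x :
  map (tsym g) (lsub l m x) = lsub (map (tsym g) l) (map (tsym g) m) x.
Proof.
rewrite !lsubE; elim: l => // -[y|c||] l IH; rewrite /= !lsubs_cons -IH ?map_cat//.
by case: eqP.
Qed.

(** A formula remains a formula of another system if its lists do; only lists
    all of whose symbols occur in the formula matter. *)
Lemma is_fmla_ftok T T' h F : preds T `<=` preds T' -> is_fmla T F ->
  (forall l, lists T l -> {subset lsyms l <= fsyms F} -> lists T' (map h l)) ->
  is_fmla T' (ftok h F).
Proof.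
move=> PT; elim: F => /=.
- move=> l m [Tl Tm] H; split; apply: H => // c cl; by rewrite mem_cat cl ?orbT.
- move=> p ls [Tp Tls] H; split; first exact: PT.
  elim: ls Tls H => //= l ls IH /andP[/set_mem Tl Tls] H; apply/andP; split.
    by apply/mem_set/H => // c cl; rewrite mem_cat cl.
  by apply: IH => // m Tm ml; apply: H => // c /ml; rewrite mem_cat orbC => ->.
- by move=> G IH TG H; exact: IH.
1-4: by move=> G IG H IH [TG TH] E; split; [apply: IG|apply: IH] => // l Tl ll;
  apply: E => // c /ll; rewrite mem_cat => ->; rewrite ?orbT.
1,2: by move=> x G IH TG H; exact: IH.
Qed.

Lemma is_fmla_mono T T' F : preds T `<=` preds T' -> lists T `<=` lists T' ->
  is_fmla T F -> is_fmla T' F.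
Proof.
move=> PT LT TF; rewrite -(ftok_id F); apply: (is_fmla_ftok PT TF) => l Tl _.
by rewrite (map_id l); apply: LT.
Qed.

Lemma is_fmla_SbF T F l x : subst_closed (lists T) -> lists T l ->
  is_fmla T F -> is_fmla T (SbF F l x).
Proof.
move=> [_ LT] Tl; elim: F => //=.
- by move=> m n [Tm Tn]; split; apply: LT.
- move=> p ls [Tp Tls]; split => //; rewrite all_map; apply: sub_all Tls => m.
  by move=> /set_mem Tm; apply/mem_set/LT.
1-4: by move=> G IG H IH [/IG ? /IH ?].
1,2: by move=> y G IG TG; case: ifP => //= _; exact: IG.
Qed.

Lemma is_system_subst_closed T : is_system T -> subst_closed (lists T).
Proof. by case. Qed.

Lemma is_fmla_eq_prems T xys F : subst_closed (lists T) -> is_fmla T F ->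
  is_fmla T (eq_prems xys F).
Proof.
by move=> [LT _] TF; elim: xys => //= -[x y] xys IH; split => //=; split; apply: LT.
Qed.

Lemma provable_is_fmla T F : is_system T -> provable T F -> is_fmla T F.
Proof.
move=> ST; have LT := is_system_subst_closed ST; have [Lv Ls] := LT.
elim=> {F}.
- by move=> F /(system_axioms ST).
- by [].
- by move=> x; split; apply: Lv.
- by move=> x y l m Tl Tm; split => /=; [split; apply: Ls|split; split].
- move=> p xys Tp _; apply: is_fmla_eq_prems => //=; split; split => //;
    by rewrite all_map; apply/allP => xy _; apply/mem_set/Lv.
- by [].
- by move=> x F G TF TG _ /=.
- by [].
- by move=> F G _ _ _ [].
- by move=> F l x _ TF Tl _; apply: is_fmla_SbF.
- by [].
Qed.

Lemma provable_mono T T' F : preds T `<=` preds T' -> lists T `<=` lists T' ->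
  axioms T `<=` provable T' -> provable T F -> provable T' F.
Proof.
move=> PT LT BT; have FT G : is_fmla T G -> is_fmla T' G by apply: is_fmla_mono.
elim=> {F}.
- by move=> F /BT.
- by move=> a s ta /FT; apply: prov_taut.
- by move=> x; apply: prov_eq_refl.
- by move=> x y l m /LT Tl /LT Tm; apply: prov_eq_subst.
- by move=> p xys /PT; apply: prov_eq_pred.
- by move=> x F /FT; apply: prov_all_elim.
- by move=> x F G /FT TF /FT TG; apply: prov_all_imp.
- by move=> x F /FT; apply: prov_ex.
- by move=> F G _ PF _; apply: prov_mp.
- by move=> F l x _ PF /LT; apply: prov_sub.
- by move=> F x _; apply: prov_gen.
Qed.

Lemma alist_mono (A A' : set Sy) l : A `<=` A' -> alist A l -> alist A' l.
Proof.
move=> AA; elim=> {l}; [exact: alist_var|by move=> a /AA; apply: alist_sym| |].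
  by move=> f l /AA ? _; apply: alist_app.
by move=> l m _ ? _; apply: alist_cat.
Qed.

Lemma alist_lsub (A : set Sy) l m x : alist A l -> alist A m -> alist A (lsub l m x).
Proof.
move=> Al Am; elim: Al => {l}.
- by move=> y; rewrite lsubE lsubs_vlist; case: ifP => // _; apply: alist_var.
- by move=> a Aa; apply: alist_sym.
- move=> f l Af _ Al; rewrite lsubE !lsubs_cat -(lsubE l); exact: (alist_app Af Al).
- move=> l n _ Al _ An; rewrite lsubE lsubs_cat -!lsubE; exact: (alist_cat Al An).
Qed.

Lemma alist_lsyms (A : set Sy) l c : alist A l -> c \in lsyms l -> A c.
Proof.
elim=> {l} [//|a Aa|f l Af _ IH|l m _ IH _ IHm].
- by rewrite inE => /eqP ->.
- by rewrite /= inE => /orP[/eqP ->|]//; rewrite lsyms_cat mem_cat orbF.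
- by rewrite lsyms_cat mem_cat => /orP[/IH|/IHm].
Qed.

Lemma alist_lext (A K : set Sy) (L : set str) l : L `<=` alist A ->
  lext L K l -> alist (A `|` K) l.
Proof.
move=> LA; elim=> {l} [l /LA|l k x _ IH Kk]; first by apply: alist_mono => a; left.
by apply: alist_lsub => //; apply: alist_sym; right.
Qed.

Lemma lext_mono (L L' : set str) (K K' : set Sy) : L `<=` L' -> K `<=` K' ->
  lext L K `<=` lext L' K'.
Proof.
move=> LL KK l; elim=> {l} [l /LL|l k x _ IH /KK Kk]; first exact: lext_base.
exact: lext_sub.
Qed.

Lemma filter_none (T0 : eqType) (P : pred T0) (s : seq T0) :
  (forall y, y \in s -> ~~ P y) -> [seq y <- s | P y] = [::].
Proof.
by move=> H; rewrite (@eq_in_filter _ P pred0) ?filter_pred0// => y /H/negbTE.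
Qed.

Lemma ffree_SbF F l x : lvar l = [::] ->
  ffree (SbF F l x) = [seq y <- ffree F | y != x].
Proof.
move=> l0; have Hl m : lvar (lsub m l x) = [seq y <- lvar m | y != x].
  rewrite lsubE lvar_lsubs; elim: (lvar m) => //= y s ->.
  by case: eqP => //; rewrite l0.
elim: F => //=.
- by move=> m n; rewrite !Hl filter_cat.
- by move=> p ls; elim: ls => //= m ls IH; rewrite IH Hl filter_cat.
1-4: by move=> G -> H ->; rewrite filter_cat.
1,2: move=> y G IH; case: eqP => [<-|yx] /=;
  [by rewrite filter_id|rewrite IH -!filter_predI; apply: eq_filter => z /=; exact: andbC].
Qed.

Lemma SbF_is_closed F l x : lvar l = [::] -> {subset ffree F <= [:: x]} ->
  closed_fmla (SbF F l x).
Proof.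
move=> l0 Fx; rewrite /closed_fmla ffree_SbF//; apply: filter_none => y /Fx.
by rewrite inE negbK.
Qed.

Lemma CF_closed F l x : lvar l = [::] -> CF F l x.
Proof.
move=> l0; elim: F => //= [G -> H ->|G -> H ->|G -> H ->|G -> H ->|y G ->|y G ->] //;
  by rewrite l0 implybT orbT.
Qed.

End Formulas.

(** * Evaluation under assignments *)

Section Semantics.
Variables (Sy : choiceType) (Pr U : Type).
Local Notation str := (seq (tok Sy)).
Local Notation fmla := (fmla Sy Pr).
Local Notation system := (system Sy Pr).
Variables (S : system) (D : model Sy Pr U).
Implicit Types (F G : fmla) (l m : str) (x y : nat) (rho : nat -> U).

(** The value of a list under an assignment of individuals to the variables:
    the names of these individuals are substituted first. *)
Definition lval rho l : U := dval D (lsubs (fun x => clist (name D (rho x))) l).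

(** [rho] with the value at [x] changed to [d]. *)
Definition upd rho x (d : U) : nat -> U := fun y => if y == x then d else rho y.

(** Truth of an arbitrary formula under an assignment, by the usual recursion
    on the formula with quantifiers ranging over the universe. *)
Fixpoint ev rho F : Prop :=
  match F with
  | FEq l m => lval rho l = lval rho m
  | FPred p ls => interp D p (map (lval rho) ls)
  | FNeg G => ~ ev rho G
  | FImp G H => ev rho G -> ev rho H
  | FIff G H => ev rho G <-> ev rho H
  | FAnd G H => ev rho G /\ ev rho H
  | FOr G H => ev rho G \/ ev rho H
  | FAll x G => forall d, universe D d -> ev (upd rho x d) G
  | FEx x G => exists2 d, universe D d & ev (upd rho x d) G
  end.

(** The assignments of individuals, that is, of members of the universe. *)
Definition env rho : Prop := forall x, universe D (rho x).

Lemma env_upd rho x d : env rho -> universe D d -> env (upd rho x d).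
Proof. by move=> Er Ud y; rewrite /upd; case: ifP. Qed.

Lemma ball_iff (A P Q : U -> Prop) : (forall d, A d -> P d <-> Q d) ->
  (forall d, A d -> P d) <-> (forall d, A d -> Q d).
Proof. by move=> H; split=> PQ d Ad; apply/(H d Ad)/PQ. Qed.

Lemma bex_iff (A P Q : U -> Prop) : (forall d, A d -> P d <-> Q d) ->
  (exists2 d, A d & P d) <-> (exists2 d, A d & Q d).
Proof. by move=> H; split=> -[d Ad /(H d Ad)]; exists d. Qed.

Lemma eq_val rho rho' l : (forall x, x \in lvar l -> rho x = rho' x) ->
  lval rho l = lval rho' l.
Proof. by move=> H; congr (dval D); apply: eq_in_lsubs => x /H ->. Qed.

Lemma val_closed rho l : lvar l = [::] -> lval rho l = dval D l.
Proof. by move=> l0; rewrite /lval lsubs_id// l0. Qed.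

Lemma eq_ev rho rho' F : (forall x, x \in ffree F -> rho x = rho' x) ->
  ev rho F = ev rho' F.
Proof.
elim: F rho rho' => /=.
- move=> l m rho rho' H; rewrite (@eq_val rho rho' l) ?(@eq_val rho rho' m)// => x xl;
    by apply: H; rewrite mem_cat xl ?orbT.
- move=> p ls rho rho' H; congr (interp D p _); elim: ls H => //= l ls IH H.
  rewrite (@eq_val rho rho' l) ?IH// => x xl; apply: H; by rewrite mem_cat xl ?orbT.
- by move=> G IH rho rho' /IH ->.
1-4: by move=> G IG H IH rho rho' E; rewrite (IG rho rho') ?(IH rho rho')// => x xl;
  apply: E; rewrite mem_cat xl ?orbT.
1,2: move=> y G IH rho rho' E; rewrite propeqE;
  (apply: ball_iff || apply: bex_iff) => d _; rewrite (IH _ (upd rho' y d))// => x xG;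
  by rewrite /upd; case: (eqVneq x y) => // xy; apply: E; rewrite mem_filter xy.
Qed.

Hypothesis S_system : is_system S.
Hypothesis D_model : is_model S D.

Let hatL := lists (hat S D).

Lemma hat_lists : subst_closed hatL.
Proof. by apply: subst_closed_lext; apply: is_system_subst_closed. Qed.

Lemma hat_name d : universe D d -> hat_closed S D (clist (name D d)).
Proof.
move=> Ud; split => //; apply: lext_clist; last by exists d.
exact: is_system_subst_closed.
Qed.

Lemma dval_universe l : hat_closed S D l -> universe D (dval D l).
Proof. exact: (model_val_fun D_model). Qed.

(** By surjectivity d is the value of some list l, and d has the same name as
   that value; now substitute l for the variable in the list [vlist 0]. *)
Lemma dval_name d : universe D d -> dval D (clist (name D d)) = d.
Proof.
move=> /(model_val_surj D_model)[l hl <-].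
have := @model_val_sub _ _ _ _ _ D_model (vlist 0) l 0 (hat_lists.1 0).
by rewrite !lsubE !lsubs_vlist /= => <-.
Qed.

Lemma env_exists : exists rho, env rho.
Proof. by have [d Ud] := model_nonempty D_model; exists (fun=> d). Qed.

Lemma hat_cl rho l : env rho -> hatL l ->
  hat_closed S D (lsubs (fun x => clist (name D (rho x))) l).
Proof.
move=> Er Ll; split; last by apply: lvar_lsubs_closed.
apply: subst_closed_lsubs => // [|x]; [exact: hat_lists|exact: (hat_name (Er x)).1].
Qed.

Lemma val_universe rho l : env rho -> hatL l -> universe D (lval rho l).
Proof. by move=> Er Ll; apply/dval_universe/hat_cl. Qed.

Lemma val_vlist rho x : env rho -> lval rho (vlist x) = rho x.
Proof. by move=> Er; rewrite /lval lsubs_vlist dval_name. Qed.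

(** Substituted variable-free lists are exchanged for the names of their values
   one at a time. *)
Lemma dval_lsubs th l : hatL l -> (forall x, hat_closed S D (th x)) ->
  dval D (lsubs th l) = lval (fun x => dval D (th x)) l.
Proof.
move=> Ll Hth; pose nm x : str := clist (name D (dval D (th x))).
have Hnm x : hat_closed S D (nm x) by apply/hat_name/dval_universe.
suff H (xs : seq nat) : dval D (lsubs th l) =
    dval D (lsubs (fun y => if y \in xs then nm y else th y) l).
  by rewrite (H (lvar l)) (@eq_in_lsubs _ _ nm)// => y ->.
elim: xs => [//|x xs ->]; have [xxs|xxs] := boolP (x \in xs).
  congr (dval D); apply: eq_in_lsubs => y _; rewrite inE.
  by case: eqP => // ->; rewrite xxs.
pose mid y := if y == x then vlist x else if y \in xs then nm y else th y.
have Hmid y : hatL (mid y).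
  rewrite /mid; case: ifP => _; first exact: hat_lists.1.
  by case: ifP => _; [apply: (Hnm y).1|apply: (Hth y).1].
have split_mid (m : str) :
    lsubs (fun y => if y == x then m else if y \in xs then nm y else th y) l =
    lsub (lsubs mid l) m x.
  rewrite lsubE lsubs_comp; apply: eq_in_lsubs => y _; rewrite /mid.
  case: eqP => _; first by rewrite lsubs_vlist eqxx.
  by case: ifP => _; rewrite // lsubs_id// (Hth y).2.
have := @model_val_sub _ _ _ _ _ D_model (lsubs mid l) (th x) x _ _ (Hth x).
rewrite -!split_mid.
have -> : (fun y => if y == x then th x else if y \in xs then nm y else th y) =
    (fun y => if y \in xs then nm y else th y).
  by apply: funext => y; case: eqP => // ->; rewrite (negbTE xxs).
move=> ->.
- by congr (dval D); apply: eq_in_lsubs => y _; rewrite inE; case: eqP => // ->.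
- by apply: subst_closed_lsubs => //; exact: hat_lists.
- move=> z /mem_lvar_lsubs[y _]; rewrite /mid inE.
  case: eqP => [_|_]; first by rewrite inE.
  by case: ifP => _ //; rewrite (Hth y).2.
Qed.

Lemma val_lsub rho l m x : env rho -> hatL l -> hatL m ->
  lval rho (lsub l m x) = lval (upd rho x (lval rho m)) l.
Proof.
move=> Er Ll Lm; rewrite {1}/lval lsubE lsubs_comp dval_lsubs// => [|y]; last first.
  apply: hat_cl => //; case: ifP => // _; exact: hat_lists.1.
apply: eq_val => y _; rewrite /upd; case: ifP => // _.
by rewrite -[RHS]val_vlist.
Qed.

Lemma ev_SbF rho F l x : env rho -> is_fmla (hat S D) F -> hatL l -> CF F l x ->
  ev rho (SbF F l x) <-> ev (upd rho x (lval rho l)) F.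
Proof.
move=> + + Ll; elim: F rho => /=.
- by move=> m n rho Er [Lm Ln] _; rewrite !val_lsub.
- move=> p ms rho Er [_ Lms] _; rewrite -map_comp.
  rewrite (_ : map _ ms = map (lval (upd rho x (lval rho l))) ms)//.
  by elim: ms Lms => //= m ms IH /andP[/set_mem Lm /IH ->]; rewrite val_lsub.
- by move=> G IH rho Er LG CG; rewrite IH.
1-4: by move=> G IG H IH rho Er [LG LH] /andP[CG CH]; rewrite IG// IH.
1,2: move=> y G IG rho Er LG; case: (eqVneq y x) => [->|yx] /=.
1,3: by move=> _; (apply: ball_iff || apply: bex_iff) => d _;
  rewrite (@eq_ev _ (upd (upd rho x (lval rho l)) x d))// => z _; rewrite /upd; case: eqP.
1,2: move=> /andP[CG /implyP yl]; (apply: ball_iff || apply: bex_iff) => d Ud;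
  rewrite IG//; last exact: env_upd.
1,2: rewrite (@eq_ev _ (upd (upd rho x (lval rho l)) y d))// => z zG;
  rewrite /upd; case: (eqVneq z x) => [zx|//]; rewrite zx eq_sym (negbTE yx);
  apply: eq_val => w wl; case: eqP => // wy;
  by move: yl; rewrite -zx zG -wy wl => /(_ isT).
Qed.

Fixpoint fsize F : nat :=
  match F with
  | FEq _ _ | FPred _ _ => 0
  | FNeg G | FAll _ G | FEx _ G => (fsize G).+1
  | FImp G H | FIff G H | FAnd G H | FOr G H => (fsize G + fsize H).+1
  end.

Lemma fsize_SbF F l x : fsize (SbF F l x) = fsize F.
Proof.
elim: F => //= [G ->|G -> H ->|G -> H ->|G -> H ->|G -> H ->|y G|y G] //;
  by case: ifP => //= _ ->.
Qed.

(** Quantifying over variable-free lists and over individuals is the same. *)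
Lemma hat_quantifiers (P : U -> Prop) (R : str -> Prop) :
  (forall l, hat_closed S D l -> R l <-> P (dval D l)) ->
  ((forall l, hat_closed S D l -> R l) <-> (forall d, universe D d -> P d)) /\
  ((exists2 l, hat_closed S D l & R l) <-> (exists2 d, universe D d & P d)).
Proof.
move=> RP; have Hn := hat_name; split; split.
- by move=> H d Ud; have Hd := Hn d Ud; rewrite -(dval_name Ud); apply/(RP _ Hd)/H.
- by move=> H l Hl; apply/(RP l Hl)/H/dval_universe.
- by case=> l Hl /(RP l Hl); exists (dval D l) => //; apply: dval_universe.
- case=> d Ud Pd; exists (clist (name D d)); first exact: Hn.
  by apply/RP; [apply: Hn|rewrite dval_name].
Qed.

(** For closed formulas the truth value given by the model, whose quantifiers
    range over variable-free lists, is the evaluation over individuals: each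
    individual is the value of a variable-free list. *)
Lemma truth_ev F rho : is_fmla (hat S D) F -> closed_fmla F -> env rho ->
  truth D F <-> ev rho F.
Proof.
have [n] := ubnP (fsize F); elim: n F rho => // n IH F rho.
rewrite /closed_fmla; case: F => /=.
- move=> l m _ [Ll Lm] Fc Er; rewrite (model_eq D_model)//.
  have [l0 m0] : lvar l = [::] /\ lvar m = [::] by move: Fc; case: (lvar l).
  by rewrite !val_closed.
- move=> p ls _ Lls Fc Er; rewrite (model_pred D_model)//.
  rewrite (_ : map (lval rho) ls = map (dval D) ls)//.
  elim: ls Fc {Lls} => //= l ls IHl; case E: (lvar l) => //= /IHl ->.
  by rewrite val_closed.
- by move=> G sz LG Gc Er; rewrite (model_neg D_model)// (IH G rho)//; lia.
1-4: move=> G H sz LGH GHc Er;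
  have [Gc Hc] : ffree G = [::] /\ ffree H = [::] by move: GHc; case: (ffree G).
1-4: rewrite (model_imp D_model, model_iff D_model, model_and D_model, model_or D_model)//;
  by case: LGH => LG LH; rewrite (IH G rho)// ?(IH H rho)//; lia.
1,2: move=> x G sz LG Gc Er;
  have Gx : {subset ffree G <= [:: x]} by
    (move=> y yG; rewrite inE; apply/negPn/negP => yx;
     have : y \in [seq y <- ffree G | y != x] by [rewrite mem_filter yx]; rewrite Gc).
1,2: have E l : hat_closed S D l -> truth D (SbF G l x) <-> ev (upd rho x (dval D l)) G
   by move=> [Ll l0]; rewrite (IH _ rho) ?fsize_SbF//;
     [rewrite ev_SbF ?val_closed//; exact: CF_closed
     |apply: is_fmla_SbF => //; exact: hat_lists
     |rewrite /closed_fmla ffree_SbF].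
- by rewrite (model_all D_model)//; apply: (hat_quantifiers E).1.
- by rewrite (model_ex D_model)//; apply: (hat_quantifiers E).2.
Qed.

Lemma ev_foldl_SbF rho F (xs : seq nat) (lam : nat -> str) : env rho ->
  is_fmla (hat S D) F -> uniq xs -> (forall x, x \in xs -> hat_closed S D (lam x)) ->
  let G := foldl (fun G x => SbF G (lam x) x) F xs in
  [/\ is_fmla (hat S D) G, ffree G = [seq y <- ffree F | y \notin xs] &
    ev rho G <-> ev (fun y => if y \in xs then dval D (lam y) else rho y) F].
Proof.
move=> Er; elim: xs F => [|x xs IH] F LF /=; first by split => //; rewrite filter_predT.
move=> /andP[xxs uxs] Hl; have [Lx cx] := Hl x (mem_head _ _).
have LF' : is_fmla (hat S D) (SbF F (lam x) x) by apply: is_fmla_SbF => //; exact: hat_lists.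
have [|LG fG eG] := IH _ LF' uxs; first by move=> y yxs; apply: Hl; rewrite inE yxs orbT.
split => //.
  rewrite fG ffree_SbF// -filter_predI; apply: eq_filter => y /=.
  by rewrite inE negb_or andbC.
rewrite eG ev_SbF//; last 2 first.
- by move=> y; case: ifP => // yxs; apply/dval_universe/Hl; rewrite inE yxs orbT.
- exact: CF_closed.
rewrite val_closed//.
set r1 := upd _ _ _; set r2 := fun y => _; suff -> : r1 = r2 by [].
by apply: funext => y; rewrite /r1 /r2 /upd inE; case: eqP => [->|].
Qed.

(** Validity, defined through substitution of variable-free lists for the free
    variables, is truth under all assignments. *)
Lemma valid_ev F : is_fmla (hat S D) F ->
  valid S D F <-> (forall rho, env rho -> ev rho F).
Proof.
move=> LF; split=> [VF rho Er|EF xs uxs xsF lam Hlam].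
  pose xs := undup (ffree F); pose lam x : str := clist (name D (rho x)).
  have Hlam x : x \in xs -> hat_closed S D (lam x) by move=> _; apply: hat_name.
  have [LG fG eG] := ev_foldl_SbF Er LF (undup_uniq _) Hlam.
  have := VF xs (undup_uniq _) (mem_undup _) lam Hlam.
  rewrite (@truth_ev _ rho)//; last first.
    by rewrite /closed_fmla fG; apply: filter_none => y; rewrite mem_undup negbK.
  rewrite eG; set r1 := fun y => _; suff -> : r1 = rho by [].
  by apply: funext => y; rewrite /r1 dval_name//; case: ifP.
have [rho Er] := env_exists.
have [LG fG eG] := ev_foldl_SbF Er LF uxs Hlam.
rewrite (@truth_ev _ rho)//; last first.
  by rewrite /closed_fmla fG; apply: filter_none => y; rewrite xsF negbK.
by apply/eG/EF => y; case: ifP => // yxs; apply/dval_universe/Hlam.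
Qed.

(** * The theory of the model *)

Lemma ev_pinst rho (s : nat -> fmla) (a : pform) :
  ev rho (pinst s a) <-> peval (fun i => `[<ev rho (s i)>]) a.
Proof.
elim: a => /=.
- by move=> i; rewrite asboolE.
- by move=> b ->; split=> /negP.
- by move=> b IHb c IHc; rewrite IHb IHc; split=> [H|/implyP//]; apply/implyP.
- move=> b IHb c IHc; rewrite IHb IHc; split=> [H|/eqP -> //]; apply/eqP.
  by apply/idP/idP => /H.
- by move=> b IHb c IHc; rewrite IHb IHc; split=> /andP.
- by move=> b IHb c IHc; rewrite IHb IHc; split=> /orP.
Qed.

Lemma is_system_Mpp : is_system (Mpp S D).
Proof.
split=> /=; [|exact: hat_lists.1|exact: hat_lists.2|by move=> G [LG _]; apply: is_fmla_mono LG].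
by move=> l; apply: (alist_lext (system_alist S_system)).
Qed.

Lemma provable_Mpp_ev F : provable (Mpp S D) F -> forall rho, env rho -> ev rho F.
Proof.
have [Lv Ls] := hat_lists.
have fm G : is_fmla (Mpp S D) G -> is_fmla (hat S D) G by apply: is_fmla_mono.
have pf G : provable (Mpp S D) G -> is_fmla (hat S D) G.
  by move/(provable_is_fmla is_system_Mpp)/fm.
elim=> {F}.
- by move=> F [LF /(valid_ev LF)].
- by move=> a s ta _ rho _; apply/ev_pinst.
- by [].
- move=> x y l m Ll Lm rho Er /= + xy.
  rewrite !val_lsub// !val_vlist// in xy *.
  suff -> : upd rho y (rho x) = rho by [].
  by apply: funext => z; rewrite /upd; case: eqP => // ->.
- move=> p xys Pp _ rho Er.
  suff H (s : seq (nat * nat)) G :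
      ((forall xy, xy \in s -> rho xy.1 = rho xy.2) -> ev rho G) ->
      ev rho (eq_prems s G).
    apply: H => E /=; rewrite -!map_comp.
    suff -> : map (lval rho \o (fun xy => vlist xy.1)) xys =
              map (lval rho \o (fun xy => vlist xy.2)) xys by [].
    by apply/eq_in_map => xy /E /=; rewrite !val_vlist.
  elim: s => [|[x y] s IH] /= H; first exact: H.
  rewrite !val_vlist// => xy; apply: IH => E; apply: H => z.
  by rewrite inE => /orP[/eqP ->|/E].
- move=> x F _ rho Er /= /(_ (rho x) (Er x)); rewrite (@eq_ev _ rho)// => y _.
  by rewrite /upd; case: eqP => // ->.
- move=> x F G _ _ xF rho Er /= H eF d Ud; apply: H => //.
  rewrite (@eq_ev _ rho)// => y yF; rewrite /upd; case: eqP => // yx.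
  by move: xF; rewrite -yx yF.
- move=> x F _ rho Er /=; split=> [/existsNP[d /not_implyP[Ud /contrapT eF]]|[d Ud eF] H].
    by exists d.
  exact: H eF.
- by move=> F G _ eF _ eFG rho Er; apply: (eFG rho Er (eF rho Er)).
- move=> F l x /pf LF eF Ll CFl rho Er; apply/ev_SbF => //; apply: eF.
  by apply: env_upd => //; apply: val_universe.
- by move=> F x _ eF rho Er d Ud; apply/eF/env_upd.
Qed.

(** The system built from the valid formulas proves nothing else: the calculus
    is sound. *)
Lemma provable_Mpp F : provable (Mpp S D) F <->
  is_fmla (hat S D) F /\ forall rho, env rho -> ev rho F.
Proof.
split=> [PF|[LF eF]]; last by apply: prov_basis; split => //; apply/valid_ev.
split; last exact: provable_Mpp_ev.
by apply: is_fmla_mono (provable_is_fmla is_system_Mpp PF).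
Qed.

Lemma provable_Mpp_closed F rho : env rho -> is_fmla (hat S D) F -> closed_fmla F ->
  provable (Mpp S D) F <-> ev rho F.
Proof.
move=> Er LF Fc; rewrite provable_Mpp; split=> [[_]|eF]; first exact.
split=> // rho' _; rewrite (@eq_ev _ rho)// => x.
by rewrite Fc.
Qed.

Lemma complete_Mpp : complete (Mpp S D).
Proof.
move=> F LF Fc; have [rho Er] := env_exists.
have {}LF : is_fmla (hat S D) F by apply: is_fmla_mono LF.
by rewrite !(@provable_Mpp_closed _ rho).
Qed.

Lemma henkin_Mpp : henkin (Mpp S D).
Proof.
move=> x F LF Fx.
have {}LF : is_fmla (hat S D) F by apply: is_fmla_mono LF.
have [rho Er] := env_exists.
have [d Ud eF] : exists2 d, universe D d & ev rho (FEx x F) -> ev (upd rho x d) F.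
  have [[d Ud eF]|nF] := pselect (ev rho (FEx x F)); first by exists d.
  by exists (rho x) => //.
have [Ld _] := hat_name Ud.
have Lsub : is_fmla (hat S D) (SbF F (clist (name D d)) x).
  by apply: is_fmla_SbF => //; exact: hat_lists.
exists (name D d); split => //; first by right; exists d.
apply/(@provable_Mpp_closed _ rho) => //=.
  rewrite /closed_fmla /= (@SbF_is_closed _ _ F (clist _) x)// filter_none// => y /Fx.
  by rewrite inE negbK.
move=> /eF eFd; apply/ev_SbF => //; first exact: CF_closed.
by rewrite val_closed// dval_name.
Qed.

End Semantics.

(** * Henkin constants and the function psi *)

Section Construction.
Variables (Sy : choiceType) (Pr U : Type).
Local Notation str := (seq (tok Sy)).
Local Notation fmla := (fmla Sy Pr).
Local Notation system := (system Sy Pr).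
Variables (S : system) (D : model Sy Pr U) (omega : nat -> fmla -> Sy).
Variables (psic : Sy -> Sy) (psi : fmla -> fmla).
Implicit Types (F G : fmla) (l : str) (c : Sy) (zs : seq (Sy * nat)).

Hypothesis S_system : is_system S.
Hypothesis D_model : is_model S D.
Hypothesis omega_henkin : henkin_constants S omega.
Hypothesis psi_constr : psi_construction S D omega psic psi.

Local Notation hs := (hsys S omega).
Local Notation hc := (hconst S omega).
Local Notation hp := (hpairs S omega).

Lemma disjoint_notin (A B : set Sy) c : A `&` B = set0 -> A c -> ~ B c.
Proof. by move=> AB Ac Bc; have : (A `&` B) c by []; rewrite AB. Qed.

Lemma hsysS n : hs n.+1 =
  System (consts (hs n) `|` hc n.+1) (preds S) (axioms S) (lext (lists (hs n)) (hc n.+1)).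
Proof. by rewrite /hsys /hconst /=; case: hstage. Qed.

Lemma hconstS n : hc n.+1 = [set omega xF.1 xF.2 | xF in hp n].
Proof. by rewrite /hpairs /hsys /hconst /=; case: hstage. Qed.

Lemma preds_hsys n : preds (hs n) = preds S.
Proof. by case: n => // n; rewrite hsysS. Qed.

Lemma hsys_lists n : subst_closed (lists (hs n)).
Proof.
elim: n => [|n IH]; first exact: is_system_subst_closed.
by rewrite hsysS; apply: subst_closed_lext.
Qed.

Lemma hsys_alist n : lists (hs n) `<=` alist (consts (hs n)).
Proof.
elim: n => [|n IH]; first exact: system_alist.
by rewrite hsysS /= => l; apply: alist_lext.
Qed.

Lemma hsys_lists_mono m n : (m <= n)%N -> lists (hs m) `<=` lists (hs n).
Proof.
elim: n => [|n IH]; first by rewrite leqn0 => /eqP ->.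
rewrite leq_eqVlt => /orP[/eqP -> //|/IH mn l /mn Ll].
by rewrite hsysS; apply: lext_base.
Qed.

Lemma is_fmla_hsys_mono m n F : (m <= n)%N -> is_fmla (hs m) F -> is_fmla (hs n) F.
Proof.
by move=> mn; apply: is_fmla_mono; [rewrite !preds_hsys|apply: hsys_lists_mono].
Qed.

Lemma consts_hsys n : consts S `<=` consts (hs n).
Proof. by elim: n => // n IH c /IH; rewrite hsysS; left. Qed.

Lemma hconst_notin n c : consts S c -> ~ hc n c.
Proof.
case: n => [_ []|n] Sc Hc; have {}Sc := consts_hsys n Sc.
by apply: (disjoint_notin (hconst_new omega_henkin n)) Hc.
Qed.

Lemma fsyms_consts (T : system) F c : lists T `<=` alist (consts T) ->
  is_fmla T F -> c \in fsyms F -> consts T c.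
Proof.
move=> LT; elim: F => //=.
- by move=> l m [/LT Tl /LT Tm]; rewrite mem_cat => /orP[]; apply: alist_lsyms.
- move=> p ls [_]; elim: ls => //= l ls IH /andP[/set_mem/LT Tl /IH Tls].
  by rewrite mem_cat => /orP[|//]; apply: alist_lsyms.
1-4: by move=> G IG H IH [/IG TG /IH TH]; rewrite mem_cat => /orP[].
Qed.

(** The action of psi on a single symbol. *)
Definition psi_sym c : Sy := if `[< exists n, hc n c >] then psic c else c.

Local Notation ptok := (tsym psi_sym).

Lemma psi_sym_consts c : consts S c -> psi_sym c = c.
Proof.
by move=> Sc; rewrite /psi_sym asboolF// => -[n /hconst_notin]; apply.
Qed.

Lemma psi_sym_hconst n c : hc n c -> psi_sym c = psic c.
Proof. by move=> Hc; rewrite /psi_sym asboolT//; exists n. Qed.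

(** Turning the constants adjoined to a list back into variables yields a list
    of the smaller set. *)
Lemma lext_unsub (L : set str) (A K : set Sy) (h : tok Sy -> tok Sy) l :
  subst_closed L -> L `<=` alist A -> lext L K l ->
  (forall t, (if t is TSym c then A c else True) -> h t = t) ->
  (forall k, K k -> k \in lsyms l -> exists y, h (TSym k) = TVar y) ->
  L (map h l).
Proof.
move=> LL LA /lext_decomp[l0 [s [Ll0 As ->]]] hA hK.
pose s' x := if x \in lvar l0 then map h (s x) else vlist x.
have -> : map h (lsubs s l0) = lsubs s' l0.
  rewrite (@eq_in_lsubs _ s' (fun x => map h (s x))); last by move=> x xl; rewrite /s' xl.
  have : forall c, c \in lsyms l0 -> A c by move=> c; apply: alist_lsyms (LA _ Ll0).
  elim: (l0) => //= t m IH Am; rewrite !lsubs_cons map_cat IH; last first.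
    by move=> c cm; apply: Am; case: t => //= d; rewrite inE cm orbT.
  by case: t Am => [x|c||] Am //=; rewrite hA//=; apply: Am; rewrite mem_head.
apply: subst_closed_lsubs => // x; rewrite /s'; case: ifP => xl; last exact: LL.1.
case: (As x) => [[y ->]|[k Kk E]]; first by rewrite /= hA//; apply: LL.1.
have [|y Ey] := hK k Kk; last by rewrite E /= Ey; apply: LL.1.
elim: (l0) xl => //= t m IH; rewrite lsubs_cons lsyms_cat mem_cat.
case: t => [z|c||] /=; last 3 first.
- by rewrite inE => /IH ->; rewrite orbT.
- by move/IH.
- by move/IH.
by rewrite inE => /orP[/eqP <-|/IH ->]; rewrite ?orbT// E mem_head.
Qed.

(** The successive replacements along a sequence of pairs of a constant and a
    variable: constants by variables, and back by names. *)
Definition trepls zs (t : tok Sy) := foldl (fun t cx => trepl cx.1 cx.2 t) t zs.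

Definition tsubs zs (t : tok Sy) := foldl (fun t cx => tsub (psic cx.1) cx.2 t) t zs.

Lemma foldl_frepl zs F : foldl (fun K cx => frepl K cx.1 cx.2) F zs = ftok (trepls zs) F.
Proof.
elim: zs F => [|[c x] zs IH] F; first by rewrite -[LHS]ftok_id.
by rewrite /= IH frepl_ftok ftok_comp.
Qed.

Lemma foldl_SbF zs F : (forall x, x \in unzip2 zs -> x \notin bound_vars F) ->
  foldl (fun K cx => SbF K (clist (psic cx.1)) cx.2) F zs = ftok (tsubs zs) F.
Proof.
elim: zs F => [|[c x] zs IH] F bF; first by rewrite -[LHS]ftok_id.
rewrite /= SbF_ftok ?bF ?mem_head// IH ?ftok_comp// => y yzs.
by rewrite bound_vars_ftok bF// inE yzs orbT.
Qed.

Lemma trepls_fixed zs t : (if t is TSym c then c \notin unzip1 zs else true) ->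
  trepls zs t = t.
Proof.
rewrite /trepls; elim: zs => //= -[c x] zs IH; case: t IH => //= d IH.
by rewrite inE negb_or => /andP[/negbTE -> /IH].
Qed.

Lemma trepls_var zs c : c \in unzip1 zs ->
  exists2 x, x \in unzip2 zs & trepls zs (TSym c) = TVar x.
Proof.
rewrite /trepls; elim: zs => //= -[d x] zs IH; rewrite inE eq_sym.
case: eqP => /= [_ _|_ /IH[y yzs ->]]; last by exists y; rewrite // inE yzs orbT.
by exists x; rewrite ?mem_head// -/(trepls zs _) trepls_fixed.
Qed.

Lemma tsubs_fixed zs t : (if t is TVar x then x \notin unzip2 zs else true) ->
  tsubs zs t = t.
Proof.
rewrite /tsubs; elim: zs => //= -[c x] zs IH; case: t IH => //= y IH.
by rewrite inE negb_or => /andP[/negbTE -> /IH].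
Qed.

(** Symbol to variable and back, with a map of symbols applied in between. *)
Lemma tsubs_trepls zs (g : Sy -> Sy) t : uniq (unzip2 zs) ->
  (if t is TVar x then x \notin unzip2 zs else true) ->
  tsubs zs (tsym g (trepls zs t)) =
  if t is TSym c then TSym (if c \in unzip1 zs then psic c else g c) else t.
Proof.
case: t => [x|c||] uz xz; try by rewrite trepls_fixed//= tsubs_fixed.
case: ifP => [|cz]; last by rewrite trepls_fixed ?cz//= tsubs_fixed.
elim: zs uz {xz} => //= -[d x] zs IH /= /andP[xzs uzs]; rewrite inE eq_sym /trepls /=.
case: eqP => /= [-> _|_ czs].
  rewrite -/(trepls zs _) trepls_fixed//= /tsubs /= eqxx.
  by rewrite -/(tsubs zs _) tsubs_fixed.
have [y yzs E] := trepls_var czs.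
rewrite -/(trepls zs _) E /tsubs /=; case: eqP yzs => [->|_ _]; first by rewrite (negbTE xzs).
by rewrite -/(tsubs zs _) -(IH uzs czs) E.
Qed.

Lemma mem_hconsts_of n F c :
  c \in hconsts_of S omega n F = (c \in fsyms F) && (c \in hc n).
Proof. by rewrite mem_rev mem_undup mem_rev mem_filter andbC. Qed.

(** On the formulas with Henkin constants, psi replaces each Henkin constant by
    the name chosen for it and changes nothing else. *)
Lemma psiE n F : is_fmla (hs n) F -> psi F = ftok ptok F.
Proof.
elim: n F => [|n IH] F TF.
  rewrite (psi_base psi_constr)// -[LHS]ftok_id; apply: eq_ftok => -[x|c||] //= cF.
  by rewrite psi_sym_consts//; apply: fsyms_consts TF cF; apply: system_alist.
set cs := hconsts_of S omega n.+1 F.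
(* Replacing at least the constants of rank n + 1 in F by variables leads to
   the preceding system. *)
have back zs : unzip1 zs = cs -> is_fmla (hs n) (ftok (trepls zs) F).
  move=> zcs; apply: (is_fmla_ftok _ TF); first by rewrite !preds_hsys.
  rewrite hsysS /= => l Ll lF.
  apply: (lext_unsub (hsys_lists n) (@hsys_alist n) Ll) => [t At|c Hc cl].
    rewrite trepls_fixed//; case: t At => //= c Ac.
    rewrite zcs mem_hconsts_of negb_and orbC; apply/orP; left.
    apply/negP => /set_mem Hc.
    by apply: (disjoint_notin (hconst_new omega_henkin n)) Hc.
  have [|x _ E] := @trepls_var zs c; last by exists x.
  by rewrite zcs mem_hconsts_of lF//; apply/mem_set.
have [cs0|cs0] := eqVneq cs [::].
  by apply: IH; rewrite -[F]ftok_id; apply: (back [::]).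
have [xs [sz uxs xsF]] := psi_step psi_constr TF cs0.
rewrite -/cs /= in sz *.
rewrite foldl_frepl (IH _ (back _ _)) ?unzip1_zip ?sz// => ->.
rewrite foldl_SbF => [|x]; last first.
  rewrite unzip2_zip ?sz// => /xsF; rewrite !bound_vars_ftok;
    apply: contra; exact: bound_vars_fvar.
rewrite !ftok_comp; apply: eq_ftok => t tF /=.
rewrite tsubs_trepls ?unzip2_zip ?sz//; last first.
  by case: t tF => //= x xF; apply/negP => /xsF; rewrite xF.
case: t tF => //= c cF; rewrite unzip1_zip ?sz// mem_hconsts_of cF /=.
by case: ifP => // /set_mem Hc; rewrite (psi_sym_hconst Hc).
Qed.

(** A pair (x; F) with no free variable of F other than x has a Henkin constant,
    of rank one more than the highest rank of those occurring in F. *)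
Lemma hpairs_exists n x F : is_fmla (hs n) F -> {subset ffree F <= [:: x]} ->
  exists m, hp m (x, F).
Proof.
elim: n => [|n IH] TF Fx; first by exists 0; split => //; left.
have [[c Hc cF]|noc] := pselect (exists2 c, hc n.+1 c & c \in fsyms F).
  by exists n.+1; split => //; right; exists c.
apply: IH => //; rewrite -[F]ftok_id; apply: (is_fmla_ftok _ TF).
  by rewrite !preds_hsys.
rewrite hsysS /= => l Ll lF.
apply: (lext_unsub (hsys_lists n) (@hsys_alist n) Ll) => // k Hk /lF kF.
by case: noc; exists k.
Qed.

(** * The system of the named witnesses *)

Local Notation tc := (tconsts S omega psic).
Local Notation tl := (tlists S omega psic).
Local Notation M' := (Mp S D omega psic psi).
Local Notation M'' := (Mpp S D).

Lemma psic_name n c : hc n c -> names D (psic c).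
Proof.
case: n => [[]|n]; rewrite hconstS => -[[x F] /= /(psi_const psi_constr)[d [Ud E _]] <-].
by exists d.
Qed.

Lemma name_notin c : names D c -> ~ consts S c.
Proof. exact: disjoint_notin (model_name_new D_model). Qed.

Lemma tconsts_mono m n : (m <= n)%N -> tc m `<=` tc n.
Proof.
elim: n => [|n IH]; first by rewrite leqn0 => /eqP ->.
by rewrite leq_eqVlt => /orP[/eqP -> //|/IH mn c /mn]; left.
Qed.

Lemma tlists_mono m n : (m <= n)%N -> tl m `<=` tl n.
Proof.
elim: n => [|n IH]; first by rewrite leqn0 => /eqP ->.
by rewrite leq_eqVlt => /orP[/eqP -> //|/IH mn l /mn]; apply: lext_base.
Qed.

Lemma tconstsP n c : (tc n `\` consts S) c ->
  exists m d, [/\ (m <= n)%N, hc m d & psic d = c].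
Proof.
elim: n => [|n IH] /= [tcc nSc] //; case: tcc => [tcc|[d Hd <-]]; last by exists n.+1, d.
by have [m [d [mn Hd E]]] := IH (conj tcc nSc); exists m, d; split => //; apply: leqW.
Qed.

Lemma tconsts_name n : tc n `\` consts S `<=` names D.
Proof. by move=> c /tconstsP[m [d [_ Hd <-]]]; apply: psic_name Hd. Qed.

Lemma hconst_tconsts n c : hc n c -> (tc n `\` consts S) (psic c).
Proof.
move=> Hc; split; last exact: name_notin (psic_name Hc).
by case: n Hc => [[]|n Hc]; right; exists c.
Qed.

Lemma consts_Mp_sub : consts M' `<=` consts M''.
Proof.
move=> c [n _ tcc] /=; have [Sc|nSc] := pselect (consts S c); first by left.
by right; apply: (@tconsts_name n).
Qed.

(** The lists of [Mp] are obtained at once by adjoining all its names. *)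
Lemma lists_hat_D0 : lists (hat S (D0 S D omega psic psi)) = lists M'.
Proof.
apply/seteqP; split=> l /=.
  elim=> {l} [l Ll|l c x _ [n _ Hl] [d [Ud [[m _ Hm] nS]] <-]]; first by exists 0.
  exists (maxn n m).+1 => //=; apply: lext_sub.
    by apply: lext_base; apply: tlists_mono Hl; apply: leq_maxl.
  split => //; left; exact: (tconsts_mono (leq_maxr n m)).
case=> n _; elim: n l => [|n IH] l /=; first exact: lext_base.
elim=> {l} [l /IH//|l c x _ Ll tcc]; apply: lext_sub => //.
have [d Ud E] := @tconsts_name n.+1 _ tcc; exists d => //; split => //.
by rewrite E; case: tcc => Tc nS; split => //; exists n.+1.
Qed.

Lemma names_D0 : names (D0 S D omega psic psi) = names' S D omega psic psi.
Proof.
apply/seteqP; split=> c; first by case=> d [_ Nd] <-.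
move=> Nc; have [[n _ tcc] nS] := Nc.
have [d Ud E] := tconsts_name (conj tcc nS).
by exists d => //; split => //; rewrite E.
Qed.

Lemma Mp_lists : subst_closed (lists M').
Proof.
rewrite -lists_hat_D0; apply: subst_closed_lext; exact: is_system_subst_closed.
Qed.

Lemma lists_Mp_sub : lists M' `<=` lists M''.
Proof.
rewrite -lists_hat_D0; apply: lext_mono => // c.
by rewrite names_D0 => -[[n _ tcc] nS]; apply: (@tconsts_name n).
Qed.

Lemma lists_Mp_psi n l : lists (hs n) l -> lists M' (map ptok l).
Proof.
suff : lists (hs n) l -> tl n (map ptok l) by move=> H /H; exists n.
elim: n l => [|n IH] l.
  move=> Ll; rewrite (_ : map ptok l = l)// -[RHS](map_id l); apply: map_eq_tok.
  case=> //= c cl; rewrite psi_sym_consts//; apply: alist_lsyms cl.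
  exact: (system_alist S_system).
rewrite hsysS /=; elim=> {l} [l /IH|l c x _ Ll Hc]; first exact: lext_base.
rewrite lsub_tsym /= (psi_sym_hconst Hc); apply: lext_sub => //.
exact: (@hconst_tconsts n.+1).
Qed.

Lemma is_fmla_psi n F : is_fmla (hs n) F -> is_fmla M' (psi F).
Proof.
move=> TF; rewrite (psiE TF); apply: (is_fmla_ftok _ TF); first by rewrite preds_hsys.
by move=> l Ll _; apply: lists_Mp_psi Ll.
Qed.

Lemma tlists_lift n l : tl n l -> exists2 l', lists (hs n) l' & map ptok l' = l.
Proof.
elim: n l => [|n IH] l /=.
  move=> Ll; exists l => //; rewrite -[RHS](map_id l); apply: map_eq_tok.
  case=> //= c cl; rewrite psi_sym_consts//; apply: alist_lsyms cl.
  exact: (system_alist S_system).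
elim=> {l} [l /IH[l' Ll' <-]|l c x _ [l' Ll' <-] tcc].
  by exists l' => //; apply: hsys_lists_mono Ll'.
have [m [d [mn Hd <-]]] := @tconstsP n.+1 _ tcc.
exists (lsub l' (clist d) x); last by rewrite lsub_tsym /= (psi_sym_hconst Hd).
apply: (hsys_lists n.+1).2 => //; apply: (hsys_lists_mono mn).
case: m Hd {mn} => [[]|m Hd]; rewrite hsysS; apply: lext_clist => //; exact: hsys_lists.
Qed.

(** Every formula of [Mp] is a value of psi. *)
Lemma Mp_fmla_lift F : is_fmla M' F ->
  exists n G, is_fmla (hs n) G /\ ftok ptok G = F.
Proof.
elim: F => /=.
- move=> l m [[n1 _ /tlists_lift[l' Ll' <-]] [n2 _ /tlists_lift[m' Lm' <-]]].
  exists (maxn n1 n2), (FEq l' m'); split => //; split.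
    by apply: hsys_lists_mono Ll'; apply: leq_maxl.
  by apply: hsys_lists_mono Lm'; apply: leq_maxr.
- move=> p ls [Sp Lls].
  suff [n [ls' [Lls' <-]]] :
      exists n ls', all [in lists (hs n)] ls' /\ map (map ptok) ls' = ls.
    by exists n, (FPred p ls'); split => //; split => //; rewrite preds_hsys.
  elim: ls Lls => [|l ls IH] /=; first by exists 0, [::].
  move=> /andP[/set_mem[n1 _ /tlists_lift[l' Ll' <-]] /IH[n2 [ls' [Lls' <-]]]].
  exists (maxn n1 n2), (l' :: ls'); split => //=; apply/andP; split.
    by apply/mem_set/(hsys_lists_mono _ Ll')/leq_maxl.
  apply: sub_all Lls' => m /set_mem Lm.
  by apply/mem_set/(hsys_lists_mono _ Lm)/leq_maxr.
- by move=> G IG /IG[n [G' [TG' <-]]]; exists n, (FNeg G').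
1-4: move=> G IG H IH [/IG[n1 [G' [TG' <-]]] /IH[n2 [H' [TH' <-]]]];
  have TG := is_fmla_hsys_mono (leq_maxl n1 n2) TG';
  have TH := is_fmla_hsys_mono (leq_maxr n1 n2) TH'; exists (maxn n1 n2).
- by exists (FImp G' H').
- by exists (FIff G' H').
- by exists (FAnd G' H').
- by exists (FOr G' H').
- by move=> x G IG /IG[n [G' [TG' <-]]]; exists n, (FAll x G').
- by move=> x G IG /IG[n [G' [TG' <-]]]; exists n, (FEx x G').
Qed.

Lemma is_fmla_Mp_hat F : is_fmla M' F -> is_fmla (hat S D) F.
Proof. by apply: is_fmla_mono => //; apply: lists_Mp_sub. Qed.

Lemma is_system_Mp : is_system M'.
Proof.
split; [|exact: Mp_lists.1|exact: Mp_lists.2|].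
  rewrite -lists_hat_D0 => l Ll; have := alist_lext (system_alist S_system) Ll.
  apply: alist_mono => c [Sc|]; first by exists 0.
  by rewrite names_D0 => -[].
move=> G [[|n] _ /=]; last by case=> F [TF _] <-; apply: is_fmla_psi TF.
case=> SG _; rewrite -(psi_base psi_constr SG); exact: (@is_fmla_psi 0).
Qed.

(** The axioms of the smaller system are the formulas of it that are valid in
    the given model: by [Mp_fmla_lift] each of its formulas is a value of psi. *)
Lemma provable_Mp F : provable M' F <-> is_fmla M' F /\ provable M'' F.
Proof.
split=> [PF|[/[dup] LF /Mp_fmla_lift[n [G [TG E]]]
  /(provable_Mpp S_system D_model)[hF vF]]].
  split; first exact: provable_is_fmla is_system_Mp PF.
  apply: provable_mono PF => //; first exact: lists_Mp_sub.
  move=> G [n _ tG]; apply: prov_basis; split.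
    by apply: is_fmla_Mp_hat; apply: (system_axioms is_system_Mp); exists n.
  by case: n tG => [[]//|n [G' [_ vG'] <-]].
apply: prov_basis; exists n.+1 => //.
have TG1 := is_fmla_hsys_mono (leqnSn n) TG.
exists G; last by rewrite (psiE TG1).
by split => //; rewrite (psiE TG1) E; apply/valid_ev.
Qed.

Lemma complete_Mp : complete M'.
Proof.
move=> F LF Fc; have := complete_Mpp S_system D_model _ Fc.
rewrite !provable_Mp => <-; last by apply: is_fmla_mono (is_fmla_Mp_hat LF).
by split=> [H|[_ H]]; [split => // PF; apply: H|case].
Qed.

(** A formula F of [Mp] is psi G for some G, and the name chosen for the Henkin
    constant of (x; G) denotes a witness of F. *)
Lemma Mp_witness x F : is_fmla M' F -> {subset ffree F <= [:: x]} ->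
  exists2 d, universe0 S D omega psic psi d &
    provable M'' (FIff (FEx x F) (SbF F (clist (name D d)) x)).
Proof.
move=> /Mp_fmla_lift[n [G [TG E]]] Fx.
have [m hG] : exists m, hp m (x, G).
  by apply: hpairs_exists TG _; move: Fx; rewrite -E ffree_tsym.
have [d [Ud Ed PG]] := psi_const psi_constr hG.
exists d; last by rewrite (psiE TG) E in PG.
have Hm : hc m.+1 (omega x G) by rewrite hconstS; exists (x, G).
by have [tcd nSd] := hconst_tconsts Hm; rewrite Ed in tcd nSd;
  split => //; split => //; exists m.+1.
Qed.

Lemma Mp_witness_ev x F : is_fmla M' F -> {subset ffree F <= [:: x]} ->
  exists2 d, universe0 S D omega psic psi d &
    forall rho, env D rho -> ev D rho (FEx x F) -> ev D (upd rho x d) F.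
Proof.
move=> LF /(Mp_witness LF)[d [Ud Nd] PF]; exists d => // rho Er eF.
have := (provable_Mpp_ev S_system D_model PF Er).1 eF.
have [Ld _] := hat_name S_system Ud.
move/(ev_SbF S_system D_model Er (is_fmla_Mp_hat LF) Ld
  (@CF_closed _ _ F (clist (name D d)) x erefl)).
by rewrite val_closed// (dval_name S_system D_model Ud).
Qed.

Lemma clist_Mp d : universe0 S D omega psic psi d -> lists M' (clist (name D d)).
Proof.
move=> Ud; rewrite -lists_hat_D0; apply: lext_clist; last by exists d.
exact: is_system_subst_closed.
Qed.

Lemma henkin_Mp : henkin M'.
Proof.
move=> x F LF Fx; have [d U0d PF] := Mp_witness LF Fx.
have [Ud [Td _]] := U0d; have Ld := clist_Mp U0d.
have LFd : is_fmla M' (SbF F (clist (name D d)) x) by apply: is_fmla_SbF => //; exact: Mp_lists.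
exists (name D d); split => //; apply/provable_Mp; split => //.
apply/(provable_Mpp S_system D_model); split; first by split; apply: is_fmla_Mp_hat.
by move=> rho Er; apply: (provable_Mpp_ev S_system D_model PF Er).1.
Qed.

Lemma extension_Mp : extension M' S.
Proof.
split=> //=; [by move=> c Sc; exists 0|by move=> l Ll; exists 0|move=> F PF].
apply: provable_mono PF => // [l Ll|G SG]; first by exists 0.
apply: prov_basis; exists 0 => //; split; first exact: (system_axioms S_system).
exact: (model_axioms D_model).
Qed.

Lemma conservative_Mpp_Mp : conservative_extension M'' M'.
Proof.
split; last by move=> F LF PF; apply/provable_Mp.
split=> //; [exact: consts_Mp_sub|exact: lists_Mp_sub|].
by move=> F /provable_Mp[].
Qed.

(** * The countable submodel *)

Local Notation D_0 := (D0 S D omega psic psi).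

(** The witness of the formula x = l is the value of l. *)
Lemma dval_universe0 l : closed_lists (lists M') l -> universe D_0 (dval D l).
Proof.
move=> [Ll l0]; have [|x|d U0d Hd] := @Mp_witness_ev 0 (FEq (vlist 0) l).
- by split=> //; exact: Mp_lists.1.
- by rewrite /= l0.
have [rho Er] := env_exists D_model.
have Ul : universe D (dval D l).
  by apply: (dval_universe D_model); split => //; apply: lists_Mp_sub.
have U0d1 := U0d.1.
suff -> : dval D l = d by [].
have := Hd rho Er; rewrite /= (@val_closed _ _ _ D _ l l0).
rewrite (val_vlist S_system D_model) ?{1}/upd ?eqxx; last exact: env_upd.
move=> -> //; exists (dval D l) => //.
by rewrite (@val_closed _ _ _ D _ l l0) (val_vlist S_system D_model);
  [rewrite /upd eqxx|exact: env_upd].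
Qed.

Lemma hat_closed_D0 : hat_closed S D_0 = closed_lists (lists M').
Proof. by rewrite /hat_closed lists_hat_D0. Qed.

Lemma hat_closed_sub : hat_closed S D_0 `<=` hat_closed S D.
Proof. by rewrite hat_closed_D0 => l [/lists_Mp_sub]. Qed.

Lemma is_fmla_hat_D0 F : is_fmla (hat S D_0) F -> is_fmla M' F.
Proof. by apply: is_fmla_mono; rewrite ?lists_hat_D0. Qed.

Lemma is_closed_fmla_D0 F : is_closed_fmla (hat S D_0) F -> is_closed_fmla (hat S D) F.
Proof. by case=> /is_fmla_hat_D0/is_fmla_Mp_hat. Qed.

Lemma truth_SbF rho x F l : env D rho -> is_fmla M' F -> {subset ffree F <= [:: x]} ->
  hat_closed S D l -> truth D (SbF F l x) <-> ev D (upd rho x (dval D l)) F.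
Proof.
move=> Er LF Fx [Ll l0]; rewrite (@truth_ev _ _ _ _ _ S_system D_model _ rho)//.
- rewrite (ev_SbF S_system D_model)//; [by rewrite val_closed|exact: is_fmla_Mp_hat|].
  exact: CF_closed.
- apply: is_fmla_SbF => //; [exact: hat_lists|exact: is_fmla_Mp_hat].
- exact: SbF_is_closed.
Qed.

Lemma hat_closed_name d : universe0 S D omega psic psi d ->
  hat_closed S D_0 (clist (name D d)).
Proof. by move=> Ud; rewrite hat_closed_D0; split => //; apply: clist_Mp. Qed.

Lemma is_model_D0 : is_model S D_0.
Proof.
have [rho Er] := env_exists D_model.
split.
- have [||d Ud _] := @Mp_witness_ev 0 (FEq (vlist 0) (vlist 0)); last by exists d.
    by split; exact: Mp_lists.1.
  by move=> x /=; rewrite !inE => /orP[].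
- by move=> d e /set_mem[Ud _] /set_mem[Ue _]; apply: (model_name_inj D_model); apply: mem_set.
- by rewrite names_D0 -subset0 => c [[_ nS]].
- by rewrite hat_closed_D0; apply: dval_universe0.
- move=> d Ud; exists (clist (name D d)); first exact: hat_closed_name.
  by rewrite /= (dval_name S_system D_model)//; case: Ud.
- move=> l m x Ll lx Hm; apply: (model_val_sub D_model) => //; last exact: hat_closed_sub.
  by apply: lists_Mp_sub; rewrite -lists_hat_D0.
- by move=> p _ ds [].
- by move=> l m /is_closed_fmla_D0; apply: (model_eq D_model).
- move=> p ls Fls /=; rewrite (model_pred D_model)//; last exact: is_closed_fmla_D0.
  split=> [Hp|[]//]; split => //=.
  case: Fls => -[_ Lls] Fc; elim: ls {Hp} Lls Fc => //= l ls IH /andP[/set_mem Ll Lls].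
  rewrite /closed_fmla /=; case E: (lvar l) => //= Fc; apply/andP; split; last exact: IH.
  by apply/mem_set/dval_universe0; split => //; rewrite -lists_hat_D0.
- by move=> F /is_closed_fmla_D0; apply: (model_neg D_model).
- by move=> F G /is_closed_fmla_D0; apply: (model_imp D_model).
- by move=> F G /is_closed_fmla_D0; apply: (model_iff D_model).
- by move=> F G /is_closed_fmla_D0; apply: (model_and D_model).
- by move=> F G /is_closed_fmla_D0; apply: (model_or D_model).
- move=> x F /is_fmla_hat_D0 LF Fx /=; rewrite (model_all D_model)//; last exact: is_fmla_Mp_hat.
  split=> [H l /hat_closed_sub/H//|H l Hl].
  (* A counterexample exists in the universe of the submodel if anywhere. *)
  have [d U0d Hd] := @Mp_witness_ev x (FNeg F) LF Fx.
  apply/(truth_SbF Er) => //; apply: contrapT => nF.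
  have Ul := dval_universe D_model Hl.
  have := H _ (hat_closed_name U0d).
  rewrite (truth_SbF Er)//; last exact/hat_closed_sub/hat_closed_name.
  rewrite (dval_name S_system D_model U0d.1).
  by apply: (Hd rho Er); exists (dval D l).
- move=> x F /is_fmla_hat_D0 LF Fx /=; rewrite (model_ex D_model)//; last exact: is_fmla_Mp_hat.
  split=> -[l Hl]; last by exists l => //; apply: hat_closed_sub.
  have [d U0d Hd] := @Mp_witness_ev x F LF Fx.
  have Ul := dval_universe D_model Hl.
  rewrite (truth_SbF Er)// => eF; exists (clist (name D d)); first exact: hat_closed_name.
  rewrite (truth_SbF Er)//; last exact/hat_closed_sub/hat_closed_name.
  by rewrite (dval_name S_system D_model U0d.1); apply: (Hd rho Er); exists (dval D l).
- move=> F SF xs uxs xsF lam Hlam; apply: (model_axioms D_model SF) => // x /Hlam.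
  exact: hat_closed_sub.
Qed.

End Construction.

(** * Countability *)

Section Countability.
Variables (Sy : choiceType) (Pr : Type).
Local Notation str := (seq (tok Sy)).
Local Notation fmla := (fmla Sy Pr).
Variables (f : Sy -> nat) (g : Pr -> nat).

Definition tok_code (t : tok Sy) : nat * nat :=
  match t with
  | TVar x => (0, x)
  | TSym c => (1, f c)
  | TLpar => (2, 0)
  | TRpar => (3, 0)
  end.

(** A code of formulas by finite trees, faithful where the codes [f] and [g] of
    the symbols are; the leaves carry numbers and codes of lists. *)
Fixpoint fmla_code (F : fmla) : GenTree.tree (nat + seq (nat * nat)) :=
  let leaf l := GenTree.Leaf (inr (map tok_code l)) in
  match F with
  | FEq l m => GenTree.Node 0 [:: leaf l; leaf m]
  | FPred p ls => GenTree.Node 1 (GenTree.Leaf (inl (g p)) :: map leaf ls)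
  | FNeg G => GenTree.Node 2 [:: fmla_code G]
  | FImp G H => GenTree.Node 3 [:: fmla_code G; fmla_code H]
  | FIff G H => GenTree.Node 4 [:: fmla_code G; fmla_code H]
  | FAnd G H => GenTree.Node 5 [:: fmla_code G; fmla_code H]
  | FOr G H => GenTree.Node 6 [:: fmla_code G; fmla_code H]
  | FAll x G => GenTree.Node 7 [:: GenTree.Leaf (inl x); fmla_code G]
  | FEx x G => GenTree.Node 8 [:: GenTree.Leaf (inl x); fmla_code G]
  end.

Variable T : system Sy Pr.
Hypothesis T_alist : lists T `<=` alist (consts T).
Hypothesis f_inj : {in consts T &, injective f}.
Hypothesis g_inj : {in preds T &, injective g}.

Lemma tok_code_inj (l m : str) : lists T l -> lists T m ->
  map tok_code l = map tok_code m -> l = m.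
Proof.
move=> /T_alist Al /T_alist Am.
have {Al} := fun c => @alist_lsyms _ _ l c Al.
have {Am} := fun c => @alist_lsyms _ _ m c Am.
elim: l m => [|t l IH] [|u m]// Hm Hl [tu lm].
have -> : l = m.
  apply: IH => // c cl; [apply: Hm; case: (u)|apply: Hl; case: (t)] => //= d;
    by rewrite inE cl orbT.
congr (_ :: _).
case: t u tu Hl Hm => [x|c||] [y|d||] //= [] => [->|cd] // Hl Hm.
by congr TSym; apply: f_inj => //; apply/mem_set; [apply: Hl|apply: Hm]; apply: mem_head.
Qed.

Lemma fmla_code_inj (F G : fmla) : is_fmla T F -> is_fmla T G ->
  fmla_code F = fmla_code G -> F = G.
Proof.
elim: F G => [l m|p ls|F IF|F IF H IH|F IF H IH|F IF H IH|F IF H IH|x F IF|x F IF]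
  [l' m'|p' ls'|F'|F' H'|F' H'|F' H'|F' H'|x' F'|x' F']//=.
- by move=> [Tl Tm] [Tl' Tm'] [/(tok_code_inj Tl Tl') -> /(tok_code_inj Tm Tm') ->].
- move=> [Tp Tls] [Tp' Tls'] [/(g_inj (mem_set Tp) (mem_set Tp')) -> Els]; congr FPred.
  elim: ls ls' Tls Tls' Els => [|l ls IH] [|l' ls']//=.
  move=> /andP[/set_mem Tl Tls] /andP[/set_mem Tl' Tls'].
  by case=> /(tok_code_inj Tl Tl') -> /(IH _ Tls Tls') ->.
- by move=> TF TF' [/(IF _ TF TF') ->].
1-4: by move=> [TF TH] [TF' TH'] [/(IF _ TF TF') -> /(IH _ TH TH') ->].
1,2: by move=> TF TF' [-> /(IF _ TF TF') ->].
Qed.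

End Countability.

Lemma countable_fmlas (Sy : choiceType) (Pr : Type) (T : system Sy Pr) :
  lists T `<=` alist (consts T) -> countable_system T -> countable (is_fmla T).
Proof.
move=> LT [/countable_injP[f f_inj] /countable_injP[g g_inj]].
have /inj_card_eq : {in (is_fmla T : set (fmla Sy Pr)) &, injective (fmla_code f g)}.
  move=> F G /set_mem TF /set_mem TG; exact: (fmla_code_inj LT f_inj g_inj TF TG).
by move/eq_countable => <-; apply: countableP.
Qed.

Lemma countableU (T : Type) (A B : set T) : countable A -> countable B ->
  countable (A `|` B).
Proof.
move=> cA cB; rewrite -bigcup2E; apply: bigcup_countable => // i _.
by rewrite /bigcup2; case: ifP => // _; case: ifP => // _; exact: countable0.
Qed.

Section CountableConstruction.
Variables (Sy : choiceType) (Pr U : Type).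
Variables (S : system Sy Pr) (D : model Sy Pr U) (omega : nat -> fmla Sy Pr -> Sy).
Variables (psic : Sy -> Sy) (psi : fmla Sy Pr -> fmla Sy Pr).
Hypothesis S_system : is_system S.
Hypothesis S_countable : countable_system S.

Lemma countable_hsys n : countable (consts (hsys S omega n)) /\
  countable (hconst S omega n).
Proof.
elim: n => [|n [IH _]]; first by split; [exact: S_countable.1|exact: countable0].
suff H : countable (hconst S omega n.+1).
  by split => //; rewrite hsysS; apply: countableU.
rewrite hconstS; apply: sub_countable (card_image_le _ _) _.
have cT : countable_system (hsys S omega n).
  by split => //; rewrite preds_hsys; exact: S_countable.2.
have cF := countable_fmlas (@hsys_alist _ _ _ omega S_system n) cT.
apply: sub_countable _ (countableX (countableP [set: nat]) cF).
by apply: subset_card_le => -[x F] [TF _ _].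
Qed.

Lemma countable_tconsts n : countable (tconsts S omega psic n).
Proof.
elim: n => [|n IH] /=; first exact: S_countable.1.
apply: countableU => //.
by apply: sub_countable (card_image_le _ _) _; exact: (countable_hsys n.+1).2.
Qed.

Lemma countable_Mp : countable_system (Mp S D omega psic psi).
Proof.
split; last exact: S_countable.2.
by apply: bigcup_countable => // n _; apply: countable_tconsts.
Qed.

Lemma countable_names' : countable (names' S D omega psic psi).
Proof.
apply: sub_countable countable_Mp.1; apply: subset_card_le => c; exact: subDsetl.
Qed.

Lemma countable_universe0 : is_model S D -> countable (universe0 S D omega psic psi).
Proof.
move=> D_model.
have inj : {in universe0 S D omega psic psi &, injective (name D)}.
  move=> d e /set_mem[Ud _] /set_mem[Ue _].
  by apply: (model_name_inj D_model); apply: mem_set.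
rewrite -(eq_countable (inj_card_eq inj)).
apply: sub_countable countable_names'; apply: subset_card_le => _ [d [_ Nd] <-].
exact: Nd.
Qed.

End CountableConstruction.

Unset Implicit Arguments.

Theorem theorem4p2 (Sy : choiceType) (Pr U : Type)
  (S : system Sy Pr) (D : model Sy Pr U)
  (omega : nat -> fmla Sy Pr -> Sy)
  (psic : Sy -> Sy) (psi : fmla Sy Pr -> fmla Sy Pr)
  (S_system : is_system S) (S_countable : countable_system S)
  (D_model : is_model S D)
  (omega_henkin : henkin_constants S omega)
  (psi_constr : psi_construction S D omega psic psi) :
  let M'' := Mpp S D in
  let M' := Mp S D omega psic psi in
  let N' := names' S D omega psic psi in
  let D_0 := D0 S D omega psic psi in
  (* (a) *)
  [/\ is_system M', countable_system M', complete M', henkin M' &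
      extension M' S] /\
  (* (b) *)
  [/\ is_system M'', complete M'', henkin M'' &
      conservative_extension M'' M'] /\
  (* (c) *)
  [/\ countable N' /\ names D_0 = N',
      closed_lists (lists M') `<=` closed_lists (lists M'') /\
      closed_lists (lists M'') = hat_closed S D,
      (* the lists of the extended system of D_0 are those of M', and D_0
         maps the variable-free ones into its universe *)
      lists (hat S D_0) = lists M' /\
      set_fun (closed_lists (lists M')) (universe D_0) (dval D),
      is_model S D_0 /\ countable_model D_0 &
      elementarily_equivalent S D D_0].
Proof.
have m0 := is_model_D0 S_system D_model omega_henkin psi_constr.
move=> M'' M' N' D_0; split; [|split].
- split; [exact: is_system_Mp|exact: countable_Mp|exact: complete_Mp|exact: henkin_Mp
         |exact: extension_Mp].
- split; [exact: is_system_Mpp|exact: complete_Mpp|exact: henkin_Mpp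
         |exact: conservative_Mpp_Mp].
- split.
  + by split; [exact: countable_names'|exact: names_D0].
  + split=> // l [Ll l0]; split => //.
    exact: lists_Mp_sub Ll.
  + split; first exact: lists_hat_D0.
    by move=> l; exact: dval_universe0.
  + by split => //; exact: countable_universe0.
  + by [].
Qed.
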